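(* Let $p \in (0,\infty)$, $\alpha \in (0,1)$, and let $(\kappa_d)_{d\in\mathbb{N}}$ be a sequence of critical values such that $\{p,\kappa_d\} \in \mathbb{T}_\alpha$. Then, for every $\boldsymbol{\vartheta} = \{\boldsymbol{\theta}_d : d \in \mathbb{N}\} \in \boldsymbol{\Theta}$ with $\boldsymbol{\theta}_d = (\theta_{1,d},\dots,\theta_{d,d})$, $$\boldsymbol{\vartheta} \in \mathscr{C}(\{p,\kappa_d\}) \quad \Longleftrightarrow \quad \frac{\sum_{i=1}^d g_p(\theta_{i,d})}{\sqrt{d}} \to \infty \quad (d\to\infty),$$ where $g_p(x) := x^2$ if $|x| \le 1$ and $g_p(x) := |x|^p$ if $|x| > 1$.
   Context: Let $\varepsilon_1,\varepsilon_2,\dots$ be i.i.d. standard normal random variables and $\boldsymbol{\varepsilon}_d = (\varepsilon_1,\dots,\varepsilon_d)$. A (sequence of) test(s) is a sequence $\varphi_d$, $d\in\mathbb{N}$, of Borel measurable functions $\varphi_d:\mathbb{R}^d \to [0,1]$; it has asymptotic size $\alpha\in[0,1]$ if $\lim_{d\to\infty}\mathbb{E}(\varphi_d(\boldsymbol{\varepsilon}_d)) = \alpha$, and $\mathbb{T}_\alpha$ denotes the set of all sequences of tests with asymptotic size $\alpha$. Let $\boldsymbol{\Theta} := \prod_{d=1}^\infty \mathbb{R}^d$ be the set of all triangular arrays $\boldsymbol{\vartheta} = \{\boldsymbol{\theta}_d: d\in\mathbb{N}\}$, $\boldsymbol{\theta}_d\in\mathbb{R}^d$. The consistency set $\mathscr{C}(\varphi_d)\subseteq\boldsymbol{\Theta}$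 of a sequence of tests $\varphi_d$ is the set of all $\boldsymbol{\vartheta}\in\boldsymbol{\Theta}$ with $\lim_{d\to\infty}\mathbb{E}(\varphi_d(\boldsymbol{\theta}_d+\boldsymbol{\varepsilon}_d)) = 1$. For $\boldsymbol{x}\in\mathbb{R}^d$ and $p\in(0,\infty)$, $\|\boldsymbol{x}\|_p := (\sum_{i=1}^d |x_i|^p)^{1/p}$ (also for $p<1$). For a sequence of real critical values $\kappa_d$, $\{p,\kappa_d\}$ denotes the sequence of tests $\mathbf{1}\{\|\cdot\|_p \ge \kappa_d\}$. *)

(* Defs.v *)
From HB Require Import structures.
From mathcomp Require Export all_boot all_order all_algebra.
From mathcomp Require Export finmap.
From mathcomp Require Export all_classical all_reals all_analysis.

Set Implicit Arguments.
Unset Strict Implicit.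
Unset Printing Implicit Defensive.

Import Order.TTheory GRing.Theory Num.Theory.
Import numFieldNormedType.Exports.

Local Open Scope classical_set_scope.
Local Open Scope ring_scope.

Section noise.
Context {d : measure_display} {T : measurableType d} {R : realType}
  (P : probability T R).

Definition mutually_independent (X : nat -> {RV P >-> R}) : Prop :=
  forall (J : {fset nat}) (B : nat -> set R),
    (forall j, measurable (B j)) ->
    P (\bigcap_(j in [set` J]) (X j @^-1` B j)) =
    (\prod_(j <- J) P (X j @^-1` B j))%E.

(* [normal_prob 0 1 A] is a meaningful probability only for measurable [A],
   hence the restriction. *)
Definition standard_normal (X : {RV P >-> R}) : Prop :=
  forall A : set R, measurable A -> distribution P X A = normal_prob 0 1 A.

Definition iid_standard_normal (eps : nat -> {RV P >-> R}) : Prop :=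
  mutually_independent eps /\ (forall i, standard_normal (eps i)).

(* The vector of the first [n] noise variables; [eps] is numbered from 0. *)
Definition noise_vec (eps : nat -> {RV P >-> R}) (n : nat) (w : T) : 'rV[R]_n :=
  \row_(i < n) eps i w.

End noise.

(* Sequences indexed by the dimension have an additional component at
   dimension 0. It is immaterial: R^0 is a singleton, and everything below
   that depends on the sequence is a limit as the dimension tends to
   infinity. *)
Section tests.
Context {R : realType}.

Definition triangular_array : Type := forall n : nat, 'rV[R]_n.

Definition test_array : Type := forall n : nat, 'rV[R]_n -> R.

Definition borel_rV (n : nat) := g_sigma_algebraType (@open 'rV[R]_n).

Definition is_test_array (phi : test_array) : Prop :=
  forall n : nat,
    measurable_fun [set: borel_rV n] (phi n : borel_rV n -> R) /\
    (forall x, 0 <= phi n x <= 1).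

Context {d : measure_display} {T : measurableType d} {P : probability T R}.
Variable eps : nat -> {RV P >-> R}.

Definition tests_of_asymptotic_size (alpha : R) : set test_array :=
  [set phi | is_test_array phi /\
    'E_P[fun w => phi n (noise_vec eps n w)]%E @[n --> \oo] --> alpha%:E].

Definition consistency_set (phi : test_array) : set triangular_array :=
  [set theta |
    'E_P[fun w => phi n (theta n + noise_vec eps n w)%R]%E @[n --> \oo] --> 1%E].

End tests.
Arguments triangular_array : clear implicits.
Arguments test_array : clear implicits.

Section p_norm.
Context {R : realType}.

(* A norm only for [1 <= p]; [0 `^ p = 0] as soon as [p != 0]. *)
Definition pnorm (p : R) (n : nat) (x : 'rV[R]_n) : R :=
  (\sum_(i < n) `|x ord0 i| `^ p) `^ p^-1.

Definition pnorm_test (p : R) (kappa : nat -> R) : test_array R :=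
  fun n => \1_[set x : 'rV[R]_n | kappa n <= pnorm p x].

Definition g_ (p x : R) : R := if `|x| <= 1 then x ^+ 2 else `|x| `^ p.

End p_norm.

(* Main.v *)
From HB Require Import structures.
Require Import Defs.
From mathcomp Require Import measurable_realfun.
From mathcomp Require Import ring lra.
Set Implicit Arguments.
Unset Strict Implicit.
Unset Printing Implicit Defensive.

Import Order.TTheory GRing.Theory Num.Theory.
Import numFieldNormedType.Exports.

Local Open Scope classical_set_scope.
Local Open Scope ring_scope.

(** Write [S_n] for the sum of the [|theta_i + eps_i|^p], so that the test rejects
    when [S_n >= c_n := max(kappa_n, 0)^p], and [m(t) := E|t + eps|^p].
    Chebyshev's inequality under the null hypothesis gives
    [c_n = n m(0) + O(sqrt n)].  Two facts about the one-dimensional Gaussian law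
    drive the proof: [m(t) - m(0)] is comparable to [g_p(t)], and the variance of
    [|t + eps|^p] is at most [del * g_p(t)^2 + O(1)] for every [del > 0].

    If [sum_i g_p(theta_i) / sqrt n] tends to infinity, the mean of [S_n] thus exceeds
    [c_n] by far more than its standard deviation.  Conversely, suppose this ratio stays
    bounded along a subsequence.  Multiply [P] by the density
    [prod_i (1 - (s / sqrt n) (1_{|eps_i| >= A} - q))] with [q := P(|eps_i| >= A)].
    This lowers the mean of [S_n] by a large multiple of [sqrt n], hence below [c_n],
    while the second moment of the density is at most [exp(s^2)]; so [S_n < c_n] keeps
    a probability bounded away from 0 under [P].  No central limit theorem is needed. *)

(** * Transfer of integrals *)

(** The entries of [theta] are arbitrary, so a few of them may carry almost all of the variance of
    the score; a normal approximation would fail there, and only second moments are used. In the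
    sufficient direction one coordinate may also carry the whole sum of the [g_p], and then the sum
    of [g_p^2] equals the square of that sum. A variance bound [O(g_p^2 + 1)] would therefore not be
    enough, which is why the factor [del] must be arbitrarily small. In the necessary direction the
    density depends on the noise alone, so its second moment is bounded uniformly in [theta]. It
    must still lower the mean: coordinates with small shift contribute a fixed amount, and the
    others are charged a loss of at most a multiple of [g_p]. These losses add up to [O(sqrt n)] and
    are multiplied by [s / sqrt n], so they cost only [O(1)]. The quadratic behaviour of [g_p] near
    0 comes from symmetry: shifts by [t] and [-t] have the same effect, so no first-order term
    survives, even for [p < 1]. *)

Section weighted_transfer.
Local Open Scope ereal_scope.
Import HBNNSimple.
Context {d d' : measure_display} {T : measurableType d} {T' : measurableType d'}
  {R : realType}.
Variables (mu : {measure set T -> \bar R}) (nu : {measure set T' -> \bar R}).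
Variables (X : T -> T') (G : T -> R) (c : R).
Hypotheses (mX : measurable_fun [set: T] X) (mG : measurable_fun [set: T] G).
Hypotheses (G0 : forall w, (0 <= G w)%R) (c0 : (0 <= c)%R).
Hypothesis indic_transfer : forall B : set T', measurable B ->
  \int[mu]_w ((\1_B (X w))%:E * (G w)%:E) = c%:E * nu B.

Let nnsfun_transfer (s : {nnsfun T' >-> R}) :
  \int[mu]_w ((s (X w))%:E * (G w)%:E) = c%:E * \int[nu]_x (s x)%:E.
Proof.
transitivity (\int[mu]_w (\sum_(r \in range s)
    ((r%:E * (\1_(s @^-1` [set r]) (X w))%:E) * (G w)%:E))).
  apply: eq_integral => w _.
  rewrite fimfunE -fsumEFin//= ge0_mule_fsuml//.
  by move=> r; exact: nnfun_muleindic_ge0.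
rewrite ge0_integral_fsum//; last 2 first.
- move=> r; apply: emeasurable_funM; last exact/measurable_EFinP; apply: measurable_funeM.
  by apply/measurable_EFinP; apply: measurableT_comp.
- by move=> r w _; apply: mule_ge0; last (by rewrite lee_fin); exact: nnfun_muleindic_ge0.
rewrite integralT_nnsfun sintegralE ge0_mule_fsumr; last first.
  by move=> r; exact: nnsfun_mulemu_ge0.
apply: eq_fsbigr => r /set_mem [x _ <-].
under eq_integral do rewrite -muleA.
rewrite ge0_integralZl//; first by rewrite indic_transfer// muleCA.
- apply: emeasurable_funM; last exact/measurable_EFinP.
  by apply/measurable_EFinP; apply: measurableT_comp.
- by move=> w _; rewrite -EFinM lee_fin mulr_ge0.
- by rewrite lee_fin.
Qed.

(** Linearity on simple functions, then monotone convergence. The weight [G] lets one statement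
    serve three times: for the Gaussian density, for maps preserving Lebesgue measure ([G = 1]), and
    for exchanging one factor of a product of independent variables ([G] is the product of the
    others). *)
Lemma weighted_transfer (h : T' -> R) : measurable_fun setT h ->
  (forall x, 0 <= h x)%R ->
  \int[mu]_w ((h (X w))%:E * (G w)%:E) = c%:E * \int[nu]_x (h x)%:E.
Proof.
move=> mh h0.
have mEh : measurable_fun setT (EFin \o h) by exact/measurable_EFinP.
pose a := nnsfun_approx measurableT mEh.
have acvg x : (a n x)%:E @[n --> \oo] --> (h x)%:E.
  have Eh0 y : [set: T'] y -> 0 <= (EFin \o h) y by move=> _; rewrite lee_fin.
  exact: (cvg_nnsfun_approx measurableT mEh Eh0 (I : [set: T'] x)).
have nda x : {homo (fun n => a n x) : m n / (m <= n)%N >-> (m <= n)%R}.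
  by move=> m n mn; exact/lefP/nd_nnsfun_approx.
have L1 : \int[mu]_w ((a n (X w))%:E * (G w)%:E) @[n --> \oo] -->
          \int[mu]_w ((h (X w))%:E * (G w)%:E).
  have -> : \int[mu]_w ((h (X w))%:E * (G w)%:E) =
            \int[mu]_w (limn (fun n => (a n (X w))%:E * (G w)%:E)).
    apply: eq_integral => w _; apply/esym/cvg_lim => //.
    by apply: cvgeZr => //; exact: acvg.
  apply: cvg_monotone_convergence => //.
  - move=> n; apply: emeasurable_funM; last exact/measurable_EFinP.
    by apply/measurable_EFinP; apply: measurableT_comp.
  - by move=> n w _; rewrite -EFinM lee_fin mulr_ge0.
  - by move=> w _ m n mn; rewrite -!EFinM lee_fin ler_wpM2r// nda.
have L2 : \int[nu]_x (a n x)%:E @[n --> \oo] --> \int[nu]_x (h x)%:E.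
  have -> : \int[nu]_x (h x)%:E = \int[nu]_x (limn (fun n => (a n x)%:E)).
    by apply: eq_integral => w _; apply/esym/cvg_lim.
  apply: cvg_monotone_convergence => //.
  - by move=> n; exact/measurable_EFinP.
  - by move=> n w _; rewrite lee_fin.
  - by move=> w _ m n mn; rewrite lee_fin nda.
have L3 : c%:E * \int[nu]_x (a n x)%:E @[n --> \oo] --> c%:E * \int[nu]_x (h x)%:E.
  exact: cvgeZl.
apply: cvg_unique L3 => //; apply: cvg_trans L1.
by apply: near_eq_cvg; apply: nearW => n; rewrite nnsfun_transfer.
Qed.
End weighted_transfer.

(** * Translation and reflection of the standard normal law *)

Section gaussian.
Context {R : realType}.
Local Notation mu := (@lebesgue_measure R).
Local Notation gam := (normal_prob (0 : R) 1).
Local Notation pdf := (normal_pdf (0 : R) 1).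
Local Open Scope ereal_scope.

(** The pushforward of Lebesgue measure by [f] agrees with it on half-open intervals, and these
    determine Lebesgue measure. *)
Lemma lebesgue_preimage (f : R -> R) (B : set R) : measurable_fun setT f ->
  (forall a b : R, mu (f @^-1` `]a, b]) = mu `]a, b]) -> measurable B ->
  mu (f @^-1` B) = mu B.
Proof.
move=> mf fab mB.
pose g : measurableTypeR R -> measurableTypeR R := f.
have mg : measurable_fun [set: measurableTypeR R] g by [].
pose m := isMeasurableFun.Build _ _ _ _ _ mg.
pose F : {mfun _ >-> _} := HB.pack g m.
apply/esym; rewrite -[RHS]/(pushforward mu F B).
apply: lebesgue_measure_unique => // _ [[a b] /= _ <-].
by rewrite -fab.
Qed.

Lemma lebesgue_preimage_addr (t : R) (B : set R) : measurable B ->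
  mu ((fun x => x + t)%R @^-1` B) = mu B.
Proof.
apply: lebesgue_preimage; first exact: measurable_funD.
move=> a b.
have -> : (fun x => x + t)%R @^-1` `]a, b] = `](a - t)%R, (b - t)%R]%classic.
  by apply/seteqP; split=> x /=; rewrite !in_itv/= ltrBlDr lerBrDr.
by rewrite !lebesgue_measure_itv/= !lte_fin ltrD2r -!EFinB; congr (if _ then (_)%:E else _); lra.
Qed.

Lemma integral_gaussE (h : R -> R) : measurable_fun setT h ->
  (forall x, 0 <= h x)%R ->
  \int[gam]_x (h x)%:E = \int[mu]_x (h x * pdf x)%:E.
Proof.
move=> mh h0.
rewrite -[LHS]mul1e -(@weighted_transfer _ _ _ _ _ mu gam id pdf 1%R)//.
- exact: measurable_normal_pdf.
- exact: normal_pdf_ge0.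
- move=> B mB; rewrite mul1e /normal_prob [RHS]integral_mkcond.
  apply: eq_integral => x _; rewrite patchE indicE.
  by case: ifPn => xB; rewrite ?mul1e ?mul0e.
Qed.

Lemma ge0_integral_invariant (f h : R -> R) : measurable_fun setT f ->
  (forall B, measurable B -> mu (f @^-1` B) = mu B) ->
  measurable_fun setT h -> (forall x, 0 <= h x)%R ->
  \int[mu]_x (h (f x))%:E = \int[mu]_x (h x)%:E.
Proof.
move=> mf fB mh h0.
rewrite -[RHS]mul1e -(@weighted_transfer _ _ _ _ _ mu mu f (cst 1%R) 1%R)//.
- by apply: eq_integral => x _; rewrite mule1.
- move=> B mB; rewrite mul1e; apply: etrans (fB B mB).
  under eq_integral do rewrite mule1.
  rewrite -[in RHS](setIT (f @^-1` B)) -integral_indic//.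
  by rewrite -[X in measurable X]setTI; exact: mf.
Qed.

Lemma normal_pdf01 x : pdf x = (normal_peak 1 * expR (- (x ^+ 2 / 2)))%R.
Proof.
rewrite normal_pdfE// /normal_fun subr0 expr1n mulNr.
by rewrite -mulr_natr mul1r.
Qed.

(** The one-dimensional Cameron-Martin formula: after translating the variable, complete the square
    in [- (x - t)^2 / 2 = - x^2 / 2 + t x - t^2 / 2]. *)
Lemma integral_gauss_shift (t : R) (h : R -> R) : measurable_fun setT h ->
  (forall x, 0 <= h x)%R ->
  \int[gam]_x (h (x + t))%:E =
  \int[gam]_x (h x * expR (t * x - t ^+ 2 / 2))%:E.
Proof.
move=> mh h0.
have mt : measurable_fun setT (fun x : R => x + t)%R by exact: measurable_funD.
have me : measurable_fun setT (fun x : R => expR (t * x - t ^+ 2 / 2))%R.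
  apply: measurableT_comp => //; apply: measurable_funD => //.
rewrite !integral_gaussE//; last 3 first.
- exact: (measurable_funM mh me).
- by move=> x; rewrite mulr_ge0// expR_ge0.
- exact: (measurableT_comp mh mt).
pose k x : R := (h x * expR (t * x - t ^+ 2 / 2) * pdf x)%R.
have k0 x : (0 <= k x)%R by rewrite /k !mulr_ge0 ?expR_ge0 ?normal_pdf_ge0.
have mk : measurable_fun setT k.
  exact: (measurable_funM (measurable_funM mh me) (measurable_normal_pdf 0 1)).
have inv := @lebesgue_preimage_addr t.
rewrite -[RHS](ge0_integral_invariant mt inv mk k0).
apply: eq_integral => x _; congr EFin.
rewrite /k -[RHS]mulrA; congr (_ * _)%R; rewrite !normal_pdf01 mulrCA -expRD.
by congr (_ * expR _)%R; field.
Qed.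

Lemma integral_gauss_opp (h : R -> R) : measurable_fun setT h ->
  (forall x, 0 <= h x)%R ->
  \int[gam]_x (h (- x))%:E = \int[gam]_x (h x)%:E.
Proof.
move=> mh h0.
rewrite !integral_gaussE//; last exact: measurableT_comp.
have k0 x : (0 <= h x * pdf x)%R by rewrite mulr_ge0 ?normal_pdf_ge0.
have mk : measurable_fun setT (fun x => h x * pdf x)%R.
  exact: (measurable_funM mh (measurable_normal_pdf 0 1)).
have mN : measurable_fun setT (-%R : R -> R) by exact: oppr_measurable.
rewrite -[RHS](ge0_integral_invariant mN (@lebesgue_measureN R) mk k0).
by apply: eq_integral => x _; rewrite !normal_pdf01 sqrrN.
Qed.

End gaussian.

(** * Functions of subexponential growth under the Gaussian law *)

(** A class closed under sums, products and shifts, all of whose members are integrable under the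
    normal law; it settles every integrability condition below. The signs of [C] and [a] are left
    free here and recovered in [subexponentialP]. *)
Definition subexponential {R : realType} (F : R -> R) : Prop :=
  measurable_fun [set: R] F /\
  exists C a : R, forall x, `|F x| <= C * expR (a * `|x|).

Section subexponential.
Context {R : realType}.
Local Notation gam := (normal_prob (0 : R) 1).
Implicit Types F G : R -> R.

Lemma subexponentialP F : subexponential F ->
  exists C a : R, [/\ 0 <= C, 0 <= a & forall x, `|F x| <= C * expR (a * `|x|)].
Proof.
move=> [_ [C [a FCa]]]; exists `|C|, `|a|; split=> // x.
apply: (le_trans (FCa x)); apply: (le_trans (ler_norm _)).
rewrite normrM ler_wpM2l// ger0_norm ?expR_ge0// ler_expR ler_wpM2r//.
exact: ler_norm.
Qed.

Lemma measurable_expR_norm (a : R) :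
  measurable_fun setT (fun x : R => expR (a * `|x|)).
Proof.
by apply: measurableT_comp => //; apply: measurable_funM.
Qed.

(** The integrand is dominated by a multiple of the normal density with standard deviation 2. With
    [y = |x|] this is [a y - y^2/2 <= a^2 - y^2/8], the difference being [(a - y/2)^2 + y^2/8]. *)
Lemma integrable_expR_norm (a : R) :
  gam.-integrable setT (EFin \o (fun x => expR (a * `|x|))).
Proof.
have me := measurable_expR_norm a.
apply/integrableP; split; first exact/measurable_EFinP.
under eq_integral => x _ do rewrite /= ger0_norm ?expR_ge0//.
rewrite integral_gaussE//.
pose K : R := normal_peak 1 * expR (a ^+ 2) / normal_peak 2.
have p2 : 0 < normal_peak (2 : R) by rewrite normal_peak_gt0.
have := integrableZl measurableT K (integrable_normal_pdf (0 : R) 2).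
move=> /integrableP[_]; apply: le_lt_trans.
apply: ge0_le_integral => //.
- by move=> x _; rewrite lee_fin mulr_ge0 ?expR_ge0 ?normal_pdf_ge0.
- apply/measurable_EFinP.
  exact: (measurable_funM me (measurable_normal_pdf 0 1)).
- apply: measurableT_comp => //; apply: measurable_funeM.
  by apply/measurable_EFinP; exact: measurable_normal_pdf.
move=> x _; rewrite -EFinM /= lee_fin.
apply: le_trans (ler_norm _).
rewrite /K normal_pdf01 (normal_pdfE 0 (_ : 2 != 0 :> R))//.
rewrite /normal_fun subr0 mulrCA -expRD [leRHS]mulrA divfK ?gt_eqF// -[leRHS]mulrA -expRD.
rewrite ler_pM2l ?normal_peak_gt0 ?oner_eq0// ler_expR -mulr_natr.
have -> : x ^+ 2 = `|x| ^+ 2 by rewrite -normrX ger0_norm ?sqr_ge0.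
move: `|x| => y.
have := sqr_ge0 (a - y / 2); have := sqr_ge0 y; rewrite !expr2; nra.
Qed.

Lemma subexponential_integrable F : subexponential F ->
  gam.-integrable setT (EFin \o F).
Proof.
move=> sF; have [C [a [C0 a0 FCa]]] := subexponentialP sF.
apply: (le_integrable measurableT _ _ (integrableZl measurableT C (integrable_expR_norm a))).
  by apply/measurable_EFinP; case: sF.
move=> x _ /=; rewrite lee_fin (le_trans (FCa x))//.
by rewrite [leRHS]ger0_norm// mulr_ge0 ?expR_ge0.
Qed.

Lemma subexponential_expR (a : R) : subexponential (fun x => expR (a * `|x|)).
Proof.
split; first exact: measurable_expR_norm.
by exists 1, a => x; rewrite mul1r ger0_norm ?expR_ge0.
Qed.

Lemma subexponential_le F G : measurable_fun setT F -> subexponential G ->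
  (forall x, `|F x| <= `|G x|) -> subexponential F.
Proof.
move=> mF [_ [C [a GCa]]] FG; split=> //; exists C, a => x.
exact: le_trans (FG x) (GCa x).
Qed.

Lemma subexponential_cst (c : R) : subexponential (fun=> c).
Proof.
split; first exact: measurable_cst.
by exists `|c|, 0 => x; rewrite mul0r expR0 mulr1.
Qed.

Lemma subexponentialM F G : subexponential F -> subexponential G ->
  subexponential (fun x => F x * G x).
Proof.
move=> sF sG.
have [C [a [C0 a0 FCa]]] := subexponentialP sF.
have [D [b [D0 b0 GDb]]] := subexponentialP sG.
split; first exact: (measurable_funM sF.1 sG.1).
exists (C * D), (a + b) => x.
by rewrite normrM mulrDl expRD mulrACA ler_pM.
Qed.

Lemma subexponentialD F G : subexponential F -> subexponential G ->
  subexponential (fun x => F x + G x).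
Proof.
move=> sF sG.
have [C [a [C0 a0 FCa]]] := subexponentialP sF.
have [D [b [D0 b0 GDb]]] := subexponentialP sG.
split; first exact: (measurable_funD sF.1 sG.1).
exists (C + D), (a + b) => x.
rewrite (le_trans (ler_normD _ _))// [leRHS]mulrDl lerD//.
  rewrite (le_trans (FCa x))// ler_wpM2l// ler_expR ler_wpM2r//; lra.
rewrite (le_trans (GDb x))// ler_wpM2l// ler_expR ler_wpM2r//; lra.
Qed.

Lemma subexponentialZ (c : R) F : subexponential F ->
  subexponential (fun x => c * F x).
Proof. exact: subexponentialM (subexponential_cst c). Qed.

Lemma subexponentialB F G : subexponential F -> subexponential G ->
  subexponential (fun x => F x - G x).
Proof.
move=> sF sG; have := subexponentialD sF (subexponentialZ (-1) sG).
by under [X in subexponential X -> _]eq_fun do rewrite mulN1r.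
Qed.

Lemma subexponentialX F n : subexponential F ->
  subexponential (fun x => F x ^+ n).
Proof.
move=> sF; elim: n => [|n ih]; first exact: subexponential_cst.
by under eq_fun do rewrite exprS; exact: subexponentialM.
Qed.

Lemma subexponential_indic (B : set R) : measurable B ->
  subexponential (\1_B : R -> R).
Proof.
move=> mB; apply: subexponential_le (subexponential_cst 1) _ => // x.
by rewrite indicE; case: (_ \in _); rewrite ?normr1 ?normr0.
Qed.

Lemma subexponential_comp_addr (t : R) F : subexponential F ->
  subexponential (fun x => F (t + x)).
Proof.
move=> sF; have [C [a [C0 a0 FCa]]] := subexponentialP sF.
split.
  have mt : measurable_fun setT (fun x : R => t + x) by exact: measurable_funD.
  exact: (measurableT_comp sF.1 mt).
exists (C * expR (a * `|t|)), a => x.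
rewrite (le_trans (FCa _))// -mulrA -expRD ler_wpM2l// ler_expR -mulrDr.
by rewrite ler_wpM2l// ler_normD.
Qed.

End subexponential.

(** * Elementary inequalities *)

Section real_inequalities.
Context {R : realType}.
Implicit Types s u x y t : R.

Lemma expR_sub1_le s : `|expR s - 1| <= `|s| * expR `|s|.
Proof.
have es := expR_gt0 s; have e1 := expR_ge1Dx (- s); have e2 := expR_ge1Dx s.
have ee : expR s * expR (- s) = 1 := expRxMexpNx_1 s.
have [s0|s0] := leP 0 s.
  rewrite (ger0_norm s0) ger0_norm; nra.
rewrite (ltr0_norm s0) ltr0_norm; last by rewrite subr_lt0 expR_lt1.
nra.
Qed.

Lemma normr_ln1D_le u : - 2^-1 <= u -> `|ln (1 + u)| <= 2 * `|u|.
Proof.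
move=> u2.
have u1 : 0 < 1 + u by lra.
have V : (1 + u)^-1 * (1 + u) = 1 by rewrite mulVf// gt_eqF.
have iV : 0 < (1 + u)^-1 by rewrite invr_gt0.
have up : ln (1 + u) <= u by apply: le_ln1Dx; lra.
have lo : - ln (1 + u) <= (1 + u)^-1 - 1.
  rewrite -lnV ?posrE// -[in leLHS](subrKC 1 (1 + u)^-1).
  by apply: le_ln1Dx; lra.
have V2 : (1 + u)^-1 <= 2 by nra.
rewrite ler_norml; apply/andP; split.
  have [u0|u0] := leP 0 u.
    by rewrite (ger0_norm u0); nra.
  by rewrite (ltr0_norm u0); nra.
by have [u0|u0] := leP 0 u; [rewrite (ger0_norm u0)|rewrite (ltr0_norm u0)]; lra.
Qed.

Lemma powR_norm_le_expR (p u : R) : 0 < p -> `|u| `^ p <= expR (p * `|u|).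
Proof.
move=> p0; have [->|u0] := eqVneq u 0.
  by rewrite normr0 powR0 ?gt_eqF// expR_ge0.
have nu : 0 < `|u| by rewrite normr_gt0.
rewrite /powR gt_eqF// ler_expR ler_pM2l//.
exact/ltW/ln_sublinear.
Qed.

(** A Lipschitz bound at [u = 0] that holds for all [u], although [|1 + u|^p] need not be Lipschitz
    near [u = -1]. For [u >= -1/2] the power is [exp (p ln (1 + u))] with the logarithm under
    control; for [u < -1/2] one has [1 < 2 |u|], and crude exponential bounds suffice. *)
Lemma powR_norm1D_sub1_le (p u : R) : 0 < p ->
  `| `|1 + u| `^ p - 1| <= (2 * p + 4) * `|u| * expR (2 * p * `|u|).
Proof.
move=> p0; have pu : 0 <= p * `|u| by rewrite mulr_ge0// ltW.
have E : 1 <= expR (2 * p * `|u|).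
  by rewrite -[leLHS]expR0 ler_expR; nra.
have [u2|u2] := leP (- 2^-1) u.
  have u1 : 0 < 1 + u by lra.
  rewrite (gtr0_norm u1) /powR gt_eqF//.
  apply: (le_trans (expR_sub1_le _)).
  have L : `|p * ln (1 + u)| <= 2 * p * `|u|.
    rewrite normrM (gtr0_norm p0) [2 * p]mulrC -mulrA ler_pM2l//.
    exact: normr_ln1D_le.
  have : expR `|p * ln (1 + u)| <= expR (2 * p * `|u|) by rewrite ler_expR.
  have := normr_ge0 (p * ln (1 + u)); have := expR_ge0 `|p * ln (1 + u)|.
  have := normr_ge0 u.
  nra.
have un : 2^-1 < `|u| by rewrite ltr0_norm; lra.
have B : `|1 + u| `^ p <= expR (p * `|u|).
  rewrite mulrC expRM; apply: ge0_ler_powR; rewrite ?nnegrE ?expR_ge0//.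
    exact: ltW.
  rewrite (le_trans (ler_normD _ _))// normr1; exact: expR_ge1Dx.
have B2 : expR (p * `|u|) <= expR (2 * p * `|u|) by rewrite ler_expR; nra.
have B0 := powR_ge0 `|1 + u| p.
rewrite (le_trans (ler_normB _ _))// normr1 ger0_norm//.
nra.
Qed.

(** Factor out [t] and apply the previous bound with [u = x / t]. The gain of [1 / |t|] over [|t|^p]
    makes the deviation negligible against [g_p] for large shifts, in the mean and in the
    variance. *)
Lemma powR_normD_sub_le (p t x : R) : 0 < p -> 1 <= `|t| ->
  `| `|t + x| `^ p - `|t| `^ p| <=
  (2 * p + 4) * (`|t| `^ p / `|t|) * expR ((2 * p + 1) * `|x|).
Proof.
move=> p0 t1; have t0 : 0 < `|t| by lra.
have tn0 : t != 0 by rewrite -normr_gt0.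
have -> : t + x = t * (1 + x / t) by field.
rewrite normrM powRM// -[X in _ - X]mulr1 -mulrBr normrM ger0_norm ?powR_ge0//.
rewrite [_ * (_ / _)]mulrC -!mulrA ler_wpM2l ?powR_ge0//.
apply: (le_trans (powR_norm1D_sub1_le _ p0)).
rewrite normrM normfV.
have V0 : 0 < `|t|^-1 by rewrite invr_gt0.
have V1 : `|t|^-1 <= 1 by rewrite invf_le1.
have x0 := normr_ge0 x.
have E1 : expR (2 * p * (`|x| / `|t|)) <= expR (2 * p * `|x|).
  rewrite ler_expR ler_wpM2l//; first by lra.
  by rewrite ler_piMr.
rewrite [(2 * p + 1) * _]mulrDl mul1r expRD.
have E2 : `|x| <= expR `|x| by have := expR_ge1Dx `|x|; lra.
have E3 := expR_ge0 (2 * p * (`|x| / `|t|)).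
have E4 : `|x| * expR (2 * p * (`|x| / `|t|)) <= expR (2 * p * `|x|) * expR `|x|.
  by rewrite mulrC ler_pM.
rewrite (_ : _ * expR _ = (2 * p + 4) * `|t|^-1 *
  (`|x| * expR (2 * p * (`|x| / `|t|)))); last by ring.
rewrite [leRHS]mulrA [leRHS](_ : _ = (2 * p + 4) * `|t|^-1 *
  (expR (2 * p * `|x|) * expR `|x|)); last by ring.
by rewrite ler_wpM2l// mulr_ge0// ?ltW//; lra.
Qed.

End real_inequalities.

(** * Moments of the shifted Gaussian law *)

Section gaussian_expectation.
Context {R : realType}.
Local Notation gam := (normal_prob (0 : R) 1).
Implicit Types F G : R -> R.

Lemma gauss_Rintegral_cst (c : R) : \int[gam]_x c = c.
Proof.
by rewrite Rintegral_cst//= (probability_setT (gam : probability _ _)) mulr1.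
Qed.

Lemma gauss_RintegralD F G : subexponential F -> subexponential G ->
  \int[gam]_x (F x + G x) = \int[gam]_x F x + \int[gam]_x G x.
Proof. by move=> sF sG; rewrite RintegralD//; exact: subexponential_integrable. Qed.

Lemma gauss_RintegralB F G : subexponential F -> subexponential G ->
  \int[gam]_x (F x - G x) = \int[gam]_x F x - \int[gam]_x G x.
Proof. by move=> sF sG; rewrite RintegralB//; exact: subexponential_integrable. Qed.

Lemma gauss_RintegralZ (c : R) F : subexponential F ->
  \int[gam]_x (c * F x) = c * \int[gam]_x F x.
Proof. by move=> sF; rewrite RintegralZl//; exact: subexponential_integrable. Qed.

Lemma gauss_le_Rintegral F G : subexponential F -> subexponential G ->
  (forall x, F x <= G x) -> \int[gam]_x F x <= \int[gam]_x G x.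
Proof.
by move=> sF sG FG; apply: le_Rintegral => //; exact: subexponential_integrable.
Qed.

Lemma gauss_Rintegral_ge0 F : (forall x, 0 <= F x) -> 0 <= \int[gam]_x F x.
Proof. by move=> F0; exact: Rintegral_ge0. Qed.

Definition tail_set (A : R) : set R := [set x | A <= `|x|].

Lemma measurable_tail_set (A : R) : measurable (tail_set A).
Proof.
rewrite (_ : tail_set A = (fun x : R => `|x|) @^-1` `[A, +oo[%classic); last first.
  by apply/seteqP; split=> x /=; rewrite /tail_set/= in_itv/= andbT.
by rewrite -[X in measurable X]setTI; exact: normr_measurable.
Qed.

Definition gauss_tail (A : R) : R := \int[gam]_x (\1_(tail_set A) x).

Lemma subexponential_tail (A : R) : subexponential (\1_(tail_set A) : R -> R).
Proof. by apply: subexponential_indic; exact: measurable_tail_set. Qed.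

Lemma gauss_tail_gt0 (A : R) : 0 <= A -> 0 < gauss_tail A.
Proof.
move=> A0; rewrite /gauss_tail -lte_fin.
have fin := integrable_fin_num measurableT
  (subexponential_integrable (subexponential_tail A)).
rewrite fineK//.
have mI : measurable (`[A, A + 1]%classic : set R) by [].
rewrite integral_gaussE//; last exact: (subexponential_tail A).1.
(* The smallest value of the density on [[A, A + 1]], an interval of length 1 inside the tail
   set. *)
pose k : R := normal_pdf 0 1 (A + 1).
have k0 : 0 < k.
  by rewrite /k normal_pdf01 mulr_gt0 ?expR_gt0 ?normal_peak_gt0 ?oner_eq0.
apply: (@lt_le_trans _ _ (\int[lebesgue_measure]_x
    (k%:E * (\1_(`[A, A + 1]%classic) x)%:E))%E).
  rewrite ge0_integralZl//=; last 2 first.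
  - exact/measurable_EFinP.
  - by rewrite lee_fin ltW.
  have L : lebesgue_measure (`[A, A + 1]%classic : set R) = 1%E.
    rewrite lebesgue_measure_itv/= lte_fin ltrDl ltr01 -EFinB.
    by congr EFin; lra.
  by rewrite integral_indic// setIT [X in (_ * X)%E]L mule1 lte_fin.
apply: ge0_le_integral => //.
- by move=> x _; rewrite -EFinM lee_fin mulr_ge0 ?(ltW k0)//.
- by apply: measurable_funeM; apply/measurable_EFinP.
- apply/measurable_EFinP.
  exact: (measurable_funM (subexponential_tail A).1 (measurable_normal_pdf 0 1)).
move=> x _; rewrite -EFinM lee_fin !indicE.
case: (boolP (x \in `[A, A + 1]%classic)) => [/set_mem/=|_]; last first.
  by rewrite mulr0 mulr_ge0 ?normal_pdf_ge0.
rewrite in_itv/= => /andP[xA xA1].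
rewrite mem_set; last by rewrite /tail_set/= ger0_norm// (le_trans A0).
rewrite mulr1 mul1r /k !normal_pdf01 ler_pM2l ?normal_peak_gt0 ?oner_eq0//.
by rewrite ler_expR; nra.
Qed.

End gaussian_expectation.

Section gauss_moment.
Context {R : realType}.
Local Notation gam := (normal_prob (0 : R) 1).
Variables (p : R) (p0 : 0 < p).

Definition moment (t : R) : R := \int[gam]_x (`|t + x| `^ p).

Lemma subexponential_powR_norm : subexponential (fun x : R => `|x| `^ p).
Proof.
apply: subexponential_le (subexponential_expR p) _.
  apply: (measurableT_comp (measurable_powR _)) => //.
by move=> x; rewrite ger0_norm ?powR_ge0// (le_trans (powR_norm_le_expR x p0))// ler_norm.
Qed.

Lemma subexponential_powR (t : R) : subexponential (fun x : R => `|t + x| `^ p).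
Proof. exact: (subexponential_comp_addr t subexponential_powR_norm). Qed.

Lemma moment_ge0 t : 0 <= moment t.
Proof. by apply: gauss_Rintegral_ge0 => x; exact: powR_ge0. Qed.

Definition far_constant : R := (2 * p + 4) * \int[gam]_x expR ((2 * p + 1) * `|x|).

Lemma far_constant_ge0 : 0 <= far_constant.
Proof.
rewrite /far_constant mulr_ge0//; first by have := p0; lra.
by apply: gauss_Rintegral_ge0 => x; exact: expR_ge0.
Qed.

Lemma moment_far t : 1 <= `|t| ->
  `|moment t - `|t| `^ p| <= far_constant * (`|t| `^ p / `|t|).
Proof.
move=> t1.
have sc : subexponential (fun=> `|t| `^ p : R) by exact: subexponential_cst.
have st := subexponential_powR t.
have se := subexponential_expR (2 * p + 1 : R).
rewrite /moment -[X in _ - X]gauss_Rintegral_cst -gauss_RintegralB//.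
apply: (le_trans (le_normr_Rintegral measurableT
  (subexponential_integrable (subexponentialB st sc)))).
rewrite /far_constant -mulrA [_ * (_ / _)]mulrC mulrA -gauss_RintegralZ//.
have sz := subexponentialZ ((2 * p + 4) * (`|t| `^ p / `|t|)) se.
apply: gauss_le_Rintegral => //.
  apply: subexponential_le sz _.
    by apply: measurableT_comp => //; exact: (subexponentialB st sc).1.
  move=> x; rewrite normr_id (le_trans (powR_normD_sub_le x p0 t1))//.
  exact: ler_norm.
by move=> x; exact: powR_normD_sub_le.
Qed.

End gauss_moment.

(** This is [exp (- t^2/2) cosh (t x)], the density with respect to the standard normal law of the
    equal mixture of the unit-variance normal laws centred at [t] and [-t]. *)
Definition gauss_cosh {R : realType} (t x : R) : R :=
  expR (- (t ^+ 2 / 2)) * ((expR (t * x) + expR (- (t * x))) / 2).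

Section gauss_cosh.
Context {R : realType}.
Local Notation gam := (normal_prob (0 : R) 1).
Implicit Types t x y : R.

Lemma expR_add_expRN_norm y : expR y + expR (- y) = expR `|y| + expR (- `|y|).
Proof.
by have [y0|y0] := leP 0 y; [rewrite ger0_norm|rewrite ltr0_norm// opprK addrC].
Qed.

Lemma gauss_cosh_norm t x : gauss_cosh t x = gauss_cosh `|t| `|x|.
Proof.
rewrite /gauss_cosh [X in _ * (X / 2)]expR_add_expRN_norm normrM.
by congr (expR (- (_ / 2)) * _); rewrite -normrX ger0_norm// sqr_ge0.
Qed.

Lemma gauss_cosh_normr t x : gauss_cosh t x = gauss_cosh t `|x|.
Proof. by rewrite gauss_cosh_norm [RHS]gauss_cosh_norm normr_id. Qed.

(** With [z = |y| / 2], the excess over 2 is [(exp z - exp (- z))^2], and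
    [exp z - exp (- z) >= z]. *)
Lemma expR_add_expRN_ge y : 2 + y ^+ 2 / 4 <= expR y + expR (- y).
Proof.
rewrite expR_add_expRN_norm.
have -> : y ^+ 2 = `|y| ^+ 2 by rewrite -normrX ger0_norm ?sqr_ge0.
have z0 : 0 <= `|y| / 2 by rewrite divr_ge0.
have -> : `|y| = `|y| / 2 + `|y| / 2 by lra.
move: (`|y| / 2) z0 => z z0.
rewrite opprD !expRD.
have e : expR z * expR (- z) = 1 := expRxMexpNx_1 z.
have e1 := expR_ge1Dx z.
have e2 : expR (- z) <= 1 by rewrite expR_le1; lra.
have e3 := expR_ge0 (- z).
rewrite expr2; nra.
Qed.

(** The same square, now bounded above through [exp z - exp (- z) <= 2 z exp z]. *)
Lemma expR_add_expRN_le y : expR y + expR (- y) - 2 <= y ^+ 2 * expR `|y|.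
Proof.
rewrite expR_add_expRN_norm.
have -> : y ^+ 2 = `|y| ^+ 2 by rewrite -normrX ger0_norm ?sqr_ge0.
have z0 : 0 <= `|y| / 2 by rewrite divr_ge0.
have -> : `|y| = `|y| / 2 + `|y| / 2 by lra.
move: (`|y| / 2) z0 => z z0.
rewrite opprD !expRD.
have e : expR z * expR (- z) = 1 := expRxMexpNx_1 z.
have e1 := expR_ge1Dx (- z - z); rewrite expRD in e1.
have e2 : expR (- z) <= expR z by rewrite ler_expR; lra.
have e3 := expR_gt0 (- z); have e4 := expR_gt0 z.
have e5 : expR z - expR (- z) <= 2 * z * expR z by nra.
have -> : expR z * expR z + expR (- z) * expR (- z) - 2 = (expR z - expR (- z)) ^+ 2.
  have : (expR z - expR (- z)) ^+ 2 = expR z * expR z + expR (- z) * expR (- z) -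
    2 * (expR z * expR (- z)) by ring.
  by rewrite e mulr1.
have -> : (z + z) ^+ 2 * (expR z * expR z) = (2 * z * expR z) ^+ 2 by ring.
rewrite lerXn2r// ?nnegrE; first by rewrite subr_ge0.
by rewrite !mulr_ge0// expR_ge0.
Qed.

(** The exponent 3 is 2 + 1: [x^2 <= exp (2 |x|)], and [exp |t x| <= exp |x|] because [|t| <= 1]. *)
Lemma gauss_cosh_le t x : `|t| <= 1 ->
  gauss_cosh t x <= 1 + t ^+ 2 * expR (3 * `|x|).
Proof.
move=> t1.
have ee : expR (- (t ^+ 2 / 2)) <= 1.
  by rewrite expR_le1 oppr_le0 mulr_ge0// sqr_ge0.
have h := expR_add_expRN_le (t * x).
have s0 : 0 <= (expR (t * x) + expR (- (t * x))) / 2.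
  by rewrite divr_ge0// addr_ge0// expR_ge0.
apply: (@le_trans _ _ ((expR (t * x) + expR (- (t * x))) / 2)).
  by rewrite /gauss_cosh ler_piMl.
have x2 : x ^+ 2 <= expR (2 * `|x|).
  have -> : x ^+ 2 = `|x| ^+ 2 by rewrite -normrX ger0_norm ?sqr_ge0.
  have -> : 2 * `|x| = `|x| + `|x| by lra.
  rewrite expRD expr2 ler_pM//; have := expR_ge1Dx `|x|; lra.
have x3 : expR `|t * x| <= expR `|x|.
  by rewrite ler_expR normrM ler_piMl.
have x4 : (t * x) ^+ 2 * expR `|t * x| <= t ^+ 2 * expR (3 * `|x|).
  rewrite exprMn -mulrA ler_wpM2l ?sqr_ge0//.
  have -> : 3 * `|x| = 2 * `|x| + `|x| by lra.
  by rewrite expRD ler_pM ?sqr_ge0 ?expR_ge0.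
have x5 : 0 <= t ^+ 2 * expR (3 * `|x|) by rewrite mulr_ge0 ?sqr_ge0 ?expR_ge0.
lra.
Qed.

Lemma gauss_cosh_mono t x y : 0 <= x -> x <= y ->
  gauss_cosh t x <= gauss_cosh t y.
Proof.
move=> x0 xy; rewrite gauss_cosh_norm [leRHS]gauss_cosh_norm.
rewrite (ger0_norm x0) (ger0_norm (le_trans x0 xy)) /gauss_cosh.
rewrite ler_wpM2l ?expR_ge0// ler_wpM2r//.
have t0 := normr_ge0 t; move: `|t| t0 => s s0.
have a0 : 0 <= s * x by rewrite mulr_ge0.
have ab : s * x <= s * y by rewrite ler_wpM2l.
move: (s * x) (s * y) a0 ab => a b a0 ab.
have e1 : expR a * expR (- a) = 1 := expRxMexpNx_1 a.
have e2 : expR b * expR (- b) = 1 := expRxMexpNx_1 b.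
have e3 : expR a <= expR b by rewrite ler_expR.
have e4 : expR (- a) <= 1 by rewrite expR_le1; lra.
have e5 : expR (- b) <= 1 by rewrite expR_le1; lra.
have e6 := expR_gt0 (- a); have e7 := expR_gt0 (- b).
(* The decrease of [exp (- y)] from [a] to [b] is at most the increase of [exp y], as the ratio
   [exp (- a) exp (- b)] is at most 1. *)
have e8 : expR (- a) - expR (- b) = (expR b - expR a) * (expR (- a) * expR (- b)).
  rewrite mulrBl; rewrite mulrCA e2 mulr1.
  by rewrite [X in _ = _ - X]mulrA e1 mul1r.
have e9 : expR (- a) * expR (- b) <= 1 by nra.
nra.
Qed.

Lemma continuous_gauss_cosh t : continuous (gauss_cosh t).
Proof.
have ct : continuous (fun y : R => t * y) by exact: mulrl_continuous.
have c1 : continuous (fun y : R => expR (t * y)).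
  by move=> x; apply: continuous_comp; [exact: ct|exact: continuous_expR].
have c2 : continuous (fun y : R => expR (- (t * y))).
  move=> x; apply: continuous_comp; last exact: continuous_expR.
  by apply: cvgN; exact: ct.
move=> x; apply: cvgM; first exact: cvg_cst.
by apply: cvgM; [apply: cvgD; [exact: c1|exact: c2]|exact: cvg_cst].
Qed.

Lemma subexponential_gauss_cosh t : subexponential (gauss_cosh t).
Proof.
rewrite /gauss_cosh; apply: subexponentialZ.
have m1 : measurable_fun setT (fun x : R => expR (t * x)).
  by apply: measurableT_comp => //; exact: mulrl_measurable.
have m2 : measurable_fun setT (fun x : R => expR (- (t * x))).
  under eq_fun do rewrite -mulNr.
  by apply: measurableT_comp => //; exact: mulrl_measurable.
have s1 : subexponential (fun x : R => expR (t * x)).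
  apply: subexponential_le (subexponential_expR `|t|) _ => // x.
  by rewrite !(ger0_norm (expR_ge0 _)) ler_expR -normrM ler_norm.
have s2 : subexponential (fun x : R => expR (- (t * x))).
  apply: subexponential_le (subexponential_expR `|t|) _ => // x.
  by rewrite !(ger0_norm (expR_ge0 _)) ler_expR -normrM -normrN ler_norm.
have := subexponentialM (subexponentialD s1 s2) (subexponential_cst 2^-1).
by [].
Qed.

(* Averaging the shifts by [t] and by [-t] removes the term of first order in [t]. *)
Lemma gauss_Rintegral_shift_even t (h : R -> R) : subexponential h ->
  (forall x, 0 <= h x) -> (forall x, h (- x) = h x) ->
  \int[gam]_x h (t + x) = \int[gam]_x (h x * gauss_cosh t x).
Proof.
have half (I : R) : I = 2^-1 * (I + I) by lra.
move=> sh h0 hN.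
have mh := sh.1.
have m1 (s : R) : measurable_fun setT (fun x : R => expR (s * x - s ^+ 2 / 2)).
  apply: measurableT_comp => //; apply: measurable_funD => //.
have s1 (s : R) : subexponential (fun x : R => expR (s * x - s ^+ 2 / 2)).
  apply: subexponential_le (subexponential_expR `|s|) _ => // x.
  rewrite !(ger0_norm (expR_ge0 _)) ler_expR -normrM.
  have := ler_norm (s * x); have := sqr_ge0 s; lra.
have S (s : R) : \int[gam]_x h (x + s) = \int[gam]_x (h x * expR (s * x - s ^+ 2 / 2)).
  by congr fine; exact: integral_gauss_shift.
have E1 : \int[gam]_x h (t + x) = \int[gam]_x h (x + t).
  by apply: eq_Rintegral => x _; rewrite addrC.
have E2 : \int[gam]_x h (t + x) = \int[gam]_x h (x - t).
  have mht : measurable_fun setT (fun x : R => h (x - t)).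
    by have := (subexponential_comp_addr (- t) sh).1; under eq_fun do rewrite addrC.
  rewrite /Rintegral -(integral_gauss_opp mht)//.
  by congr fine; apply: eq_integral => x _; rewrite -hN opprD addrC.
have -> : \int[gam]_x h (t + x) =
    2^-1 * (\int[gam]_x h (x + t) + \int[gam]_x h (x - t)).
  by rewrite -E1 -E2 -half.
rewrite !S -gauss_RintegralD; [|exact: subexponentialM..].
rewrite -gauss_RintegralZ; last first.
  by apply: subexponentialD; exact: subexponentialM.
apply: eq_Rintegral => x _; rewrite /gauss_cosh sqrrN !expRD mulNr; ring.
Qed.

Lemma gauss_Rintegral_cosh t : \int[gam]_x gauss_cosh t x = 1.
Proof.
have h1 : \int[gam]_x (1 : R) = \int[gam]_x (1 * gauss_cosh t x).
  apply: (@gauss_Rintegral_shift_even t (fun=> 1)) => // ; exact: subexponential_cst.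
rewrite -[RHS]gauss_Rintegral_cst h1.
by apply: eq_Rintegral => x _; rewrite mul1r.
Qed.

End gauss_cosh.

(** * Upper bound for the shifted moment, and lower bound for bounded shifts *)

Section moment_estimates.
Context {R : realType}.
Local Notation gam := (normal_prob (0 : R) 1).
Implicit Types p t x : R.

Lemma g_ge0 p t : 0 <= g_ p t.
Proof. by rewrite /g_; case: ifP => _; rewrite ?sqr_ge0 ?powR_ge0. Qed.

Lemma g_small p t : `|t| <= 1 -> g_ p t = t ^+ 2.
Proof. by rewrite /g_ => ->. Qed.

Lemma g_large p t : 1 < `|t| -> g_ p t = `|t| `^ p.
Proof. by rewrite /g_ leNgt => ->. Qed.

Lemma powR_norm_ge1 p t : 0 < p -> 1 <= `|t| -> 1 <= `|t| `^ p.
Proof.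
move=> p0 t1; have -> : 1 = 1 `^ p :> R by rewrite powR1.
by apply: ge0_ler_powR; rewrite ?nnegrE// ltW.
Qed.

Lemma moment0 p : moment p 0 = \int[gam]_x (`|x| `^ p).
Proof. by apply: eq_Rintegral => x _; rewrite add0r. Qed.

Lemma momentE p t : 0 < p ->
  moment p t = \int[gam]_x (`|x| `^ p * gauss_cosh t x).
Proof.
move=> p0; apply: gauss_Rintegral_shift_even.
- exact: subexponential_powR_norm.
- by move=> x; exact: powR_ge0.
- by move=> x; rewrite normrN.
Qed.

(** For [|t| <= 1] integrate [gauss_cosh_le] against [|x|^p]; for [|t| > 1] the far estimate gives
    at most [(1 + far_constant p) |t|^p]. *)
Lemma moment_le p : 0 < p ->
  exists2 C : R, 0 <= C & forall t, moment p t <= moment p 0 + C * g_ p t.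
Proof.
move=> p0.
have sp := @subexponential_powR_norm R p p0.
have se := subexponential_expR (3 : R).
have [C1 C10 near] : exists2 C1 : R, 0 <= C1 &
    forall t, `|t| <= 1 -> moment p t <= moment p 0 + C1 * t ^+ 2.
  exists (\int[gam]_x (`|x| `^ p * expR (3 * `|x|))).
    by apply: gauss_Rintegral_ge0 => x; rewrite mulr_ge0 ?powR_ge0 ?expR_ge0.
  move=> t t1.
  rewrite momentE// moment0 mulrC -gauss_RintegralZ; last exact: subexponentialM.
  rewrite -gauss_RintegralD//; last by apply: subexponentialZ; exact: subexponentialM.
  apply: gauss_le_Rintegral.
  - by apply: subexponentialM => //; exact: subexponential_gauss_cosh.
  - by apply: subexponentialD => //; apply: subexponentialZ; exact: subexponentialM.
  move=> x; rewrite [X in _ + X]mulrCA -[X in _ <= X + _]mulr1 -mulrDr.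
  by rewrite ler_wpM2l ?powR_ge0// gauss_cosh_le.
have K0 := @far_constant_ge0 R p p0; have far := @moment_far R p p0.
have m0 := @moment_ge0 R p 0.
move: (far_constant p) (moment p) K0 far near m0 => K m K0 far near m0.
exists (C1 + (1 + K)); first by lra.
move=> t; have [t1|t1] := leP `|t| 1.
  rewrite g_small//; have := near t t1; have := sqr_ge0 t; nra.
rewrite g_large//; have := far t (ltW t1); rewrite ler_norml => /andP[_ h].
have tp := powR_ge0 `|t| p.
have : `|t| `^ p / `|t| <= `|t| `^ p.
  by rewrite ler_piMr// invf_le1 ?ltW//; lra.
nra.
Qed.

Lemma expR_mul1D_le (v M : R) : 0 <= v -> v <= M ->
  expR v * (1 + 2 * v) <= 1 + 3 * expR M * v.
Proof.
move=> v0 vM.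
have e1 := expR_ge1Dx (- v); have e2 := expR_gt0 v.
have e3 : expR v * expR (- v) = 1 := expRxMexpNx_1 v.
have e4 : expR v <= expR M by rewrite ler_expR.
have e5 : expR v <= 1 + v * expR v by nra.
have e6 : v * expR v <= v * expR M by rewrite ler_wpM2l.
nra.
Qed.

(** With [v = t^2/2], it suffices that [exp v (1 + 2 v) <= 1 + t^2 x^2 / 8]. The left side is at
    most [1 + 3 exp (K^2/2) v], so [x^2 >= 12 exp (K^2/2)] is needed; the added 1 gives [|x| >= 1],
    hence [x^2 >= |x|]. *)
Lemma gauss_cosh_ge (K t x : R) : `|t| <= K ->
  1 + 12 * expR (K ^+ 2 / 2) <= `|x| -> 1 + t ^+ 2 <= gauss_cosh t x.
Proof.
move=> tK xX.
have tK2 : t ^+ 2 / 2 <= K ^+ 2 / 2.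
  rewrite ler_pM2r//.
  have -> : t ^+ 2 = `|t| ^+ 2 by rewrite -normrX ger0_norm ?sqr_ge0.
  by rewrite lerXn2r// nnegrE ?(le_trans _ tK).
have t2 : 0 <= t ^+ 2 / 2 by rewrite divr_ge0 ?sqr_ge0.
have e := expR_mul1D_le t2 tK2.
have E0 := expR_gt0 (K ^+ 2 / 2).
have x2 : 12 * expR (K ^+ 2 / 2) <= x ^+ 2.
  have -> : x ^+ 2 = `|x| ^+ 2 by rewrite -normrX ger0_norm ?sqr_ge0.
  rewrite expr2; nra.
have h := expR_add_expRN_ge (t * x).
rewrite /gauss_cosh expRN ler_pdivlMl ?expR_gt0//.
have -> : expR (t ^+ 2 / 2) * (1 + t ^+ 2) = expR (t ^+ 2 / 2) * (1 + 2 * (t ^+ 2 / 2)).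
  by congr (_ * (1 + _)); lra.
apply: (le_trans e).
have : t ^+ 2 * (12 * expR (K ^+ 2 / 2)) <= t ^+ 2 * x ^+ 2.
  by rewrite ler_wpM2l ?sqr_ge0.
rewrite exprMn in h; lra.
Qed.

Lemma moment_near_ge p (K : R) : 0 < p -> 0 <= K ->
  exists2 c : R, 0 < c &
    forall t, `|t| <= K -> moment p 0 + c * t ^+ 2 <= moment p t.
Proof.
move=> p0 K0.
pose X : R := 1 + 12 * expR (K ^+ 2 / 2).
have X0 : 0 < X by rewrite /X; have := expR_gt0 (K ^+ 2 / 2); lra.
(* The crossing point [r] below depends on [t] but never exceeds [X], which depends on [K] only.
   Hence [|x|^p - r^p >= D] whenever [|x| >= X + 1], uniformly in [t]. *)
pose D : R := (X + 1) `^ p - X `^ p.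
have D0 : 0 < D.
  by rewrite subr_gt0 gt0_ltr_powR// ?nnegrE; lra.
have q0 : 0 < gauss_tail (X + 1) by apply: gauss_tail_gt0; lra.
exists (D * gauss_tail (X + 1)); first exact: mulr_gt0.
move=> t tK.
have [r rX r1] : exists2 r, r \in `[0, X] & gauss_cosh t r = 1.
  apply: IVT; first exact: ltW.
    by apply: continuous_subspaceT => x; exact: continuous_gauss_cosh.
  have c0 : gauss_cosh t 0 <= 1.
    rewrite /gauss_cosh mulr0 oppr0 expR0 -mulr2n divff// mulr1 expR_le1.
    by rewrite oppr_le0 divr_ge0 ?sqr_ge0.
  have cX : 1 <= gauss_cosh t X.
    rewrite (le_trans _ (@gauss_cosh_ge K t X tK _))//.
      by rewrite lerDl sqr_ge0.
    by rewrite gtr0_norm.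
  by rewrite ge_min le_max c0 cX orbT.
move: rX; rewrite in_itv/= => /andP[r0 rX].
(* [gauss_cosh t - 1] changes sign at [r] only and has mean 0, so it may be
   integrated against [|x|^p - r^p], which changes sign there too. *)
have key x : D * t ^+ 2 * \1_(tail_set (X + 1)) x <=
    (`|x| `^ p - r `^ p) * (gauss_cosh t x - 1).
  have [xr|xr] := leP `|x| r.
    rewrite indicE memNset ?mulr0; last by rewrite /tail_set/=; lra.
    rewrite mulr_le0//.
      by rewrite subr_le0 ge0_ler_powR// ?nnegrE// ltW.
    by rewrite subr_le0 -r1 gauss_cosh_normr gauss_cosh_mono.
  have p1 : r `^ p <= `|x| `^ p by rewrite ge0_ler_powR// ?nnegrE// ltW.
  have c1 : 1 <= gauss_cosh t x.
    by rewrite -r1 [leRHS]gauss_cosh_normr gauss_cosh_mono// ltW.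
  rewrite indicE; case: (boolP (_ \in _)) => [/set_mem|_]; last first.
    by rewrite mulr0 mulr_ge0// subr_ge0.
  rewrite /tail_set/= => Xx; rewrite mulr1.
  rewrite ler_pM ?sqr_ge0//; first exact: ltW.
    rewrite lerB// ge0_ler_powR// ?nnegrE ?ltW//; lra.
  rewrite lerBrDl; apply: gauss_cosh_ge tK _; rewrite -/X; lra.
have sp := @subexponential_powR_norm R p p0.
have sc := @subexponential_gauss_cosh R t.
have s1 := subexponential_cst (1 : R).
have sr := subexponential_cst (r `^ p : R).
have st := @subexponential_tail R (X + 1).
have := gauss_le_Rintegral (subexponentialZ (D * t ^+ 2) st)
  (subexponentialM (subexponentialB sp sr) (subexponentialB sc s1)) key.
rewrite gauss_RintegralZ// -/(gauss_tail _).
have -> : \int[gam]_x ((`|x| `^ p - r `^ p) * (gauss_cosh t x - 1)) =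
   moment p t - moment p 0.
  transitivity (\int[gam]_x ((`|x| `^ p * gauss_cosh t x - `|x| `^ p) -
      r `^ p * (gauss_cosh t x - 1))).
    by apply: eq_Rintegral => x _; ring.
  have sm := subexponentialM sp sc.
  have sB := subexponentialB sc s1.
  have sZ := subexponentialZ (r `^ p) sB.
  rewrite gauss_RintegralB//; last exact: subexponentialB.
  rewrite gauss_RintegralZ// [in X in _ - _ * X]gauss_RintegralB//.
  rewrite gauss_Rintegral_cosh gauss_Rintegral_cst subrr mulr0 subr0.
  by rewrite (gauss_RintegralB sm sp) (momentE t p0) moment0.
rewrite lerBrDl; apply: le_trans.
by rewrite lerD2l mulrAC.
Qed.

End moment_estimates.

(** * Lower bound for the moment at every shift, spread, and correlation with the tail *)

Section spread.
Context {R : realType}.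
Local Notation gam := (normal_prob (0 : R) 1).
Implicit Types p t x : R.

Lemma moment_ge p : 0 < p ->
  exists2 c : R, 0 < c & forall t, moment p 0 + c * g_ p t <= moment p t.
Proof.
move=> p0.
have F0 := @far_constant_ge0 R p p0; have far := @moment_far R p p0.
move: (far_constant p) F0 far => F F0 far.
have m0 := @moment_ge0 R p 0.
have [L L0 Lp] : exists2 L : R, 0 <= L & L `^ p = 4 * moment p 0.
  exists ((4 * moment p 0) `^ p^-1); first exact: powR_ge0.
  by rewrite -powRrM mulVf ?gt_eqF// powRr1// mulr_ge0.
have [K [K1 KF KL]] : exists K : R, [/\ 1 <= K, 2 * F <= K & L <= K].
  by exists (1 + 2 * F + L); split; lra.
have [c c0 near] := moment_near_ge p0 (le_trans ler01 K1).
move: (moment p) m0 near far Lp => m m0 near far Lp.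
have Kp : 1 <= K `^ p.
  by have := @powR_norm_ge1 R p K p0; rewrite ger0_norm; [exact|lra].
have Kp0 : 0 < (K `^ p)^-1 by rewrite invr_gt0; lra.
have KV : K `^ p * (K `^ p)^-1 = 1 by rewrite mulfV// gt_eqF//; lra.
(* Between 1 and [K] the quadratic bound is converted by [|t|^p / K^p <= 1 <= t^2], hence [c / K^p];
   the value 1/4 is the surplus beyond [K]. *)
have [c1 [c10 ge_c ge_4]] : exists c1, [/\ 0 < c1, c1 <= c / K `^ p & c1 <= 4^-1].
  exists (Num.min (c / K `^ p) 4^-1).
  by rewrite lt_min mulr_gt0//= !ge_min !lexx orbT.
exists c1 => // t.
have g0 := g_ge0 p t.
have [t1|t1] := leP `|t| 1.
  apply: le_trans (near t (le_trans t1 K1)); rewrite g_small// lerD2l.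
  rewrite ler_wpM2r ?sqr_ge0// (le_trans ge_c)// ler_piMr ?(ltW c0)//.
  by rewrite invf_le1// (lt_le_trans ltr01).
have [tK|tK] := leP `|t| K.
  apply: le_trans (near t tK); rewrite g_large// lerD2l.
  have h1 : `|t| `^ p <= K `^ p.
    by apply: ge0_ler_powR; rewrite ?nnegrE ?(ltW p0)//; lra.
  have h2 : 1 <= t ^+ 2.
    by rewrite -[t ^+ 2]ger0_norm ?sqr_ge0// normrX exprn_ege1// ltW.
  have h3 : c1 * `|t| `^ p <= c / K `^ p * K `^ p.
    by apply: ler_pM => //; rewrite ?powR_ge0// ltW.
  rewrite (le_trans h3)// divfK ?gt_eqF ?(lt_le_trans ltr01)//.
  by rewrite ler_peMr// (ltW c0).
have tL : 4 * m 0 <= `|t| `^ p.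
  by rewrite -Lp; apply: ge0_ler_powR; rewrite ?nnegrE ?(ltW p0)//; lra.
have := far t (ltW t1); rewrite ler_norml => /andP[h _].
have tp := powR_ge0 `|t| p.
have h2 : F * (`|t| `^ p / `|t|) <= 2^-1 * `|t| `^ p.
  rewrite [leRHS]mulrC mulrCA ler_wpM2l// ler_pdivrMr ?(lt_trans ltr01)//.
  by lra.
have h3 : c1 * `|t| `^ p <= 4^-1 * `|t| `^ p.
  by rewrite ler_wpM2r.
rewrite g_large//.
move: h h2 h3 tL tp; clear; lra.
Qed.

(** Centred at [|t|^p] instead of the mean: a second moment about any point dominates the variance,
    and the pointwise bound [powR_normD_sub_le] applies to this centre directly. *)
Definition spread (p t : R) : R := \int[gam]_x ((`|t + x| `^ p - `|t| `^ p) ^+ 2).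

Lemma subexponential_spread p t : 0 < p ->
  subexponential (fun x : R => (`|t + x| `^ p - `|t| `^ p) ^+ 2).
Proof.
move=> p0; apply: subexponentialX; apply: subexponentialB.
  exact: subexponential_powR.
exact: subexponential_cst.
Qed.

Lemma spread_le p (del : R) : 0 < p -> 0 < del ->
  exists2 D : R, 0 <= D & forall t, spread p t <= del * g_ p t ^+ 2 + D.
Proof.
move=> p0 del0.
pose a : R := (2 * p + 1) + (2 * p + 1).
pose M : R := (2 * p + 4) ^+ 2 * \int[gam]_x expR (a * `|x|).
have M0 : 0 <= M.
  rewrite mulr_ge0 ?sqr_ge0//.
  by apply: gauss_Rintegral_ge0 => x; exact: expR_ge0.
(* For [|t| > K] the spread is at most [M |t|^(2p) / t^2], and [M / t^2 <= del] follows from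
   [M / del <= |t| <= t^2]. Shifts up to [K] are absorbed in [D]. *)
pose K : R := 1 + M / del.
have Md0 : 0 <= M / del by rewrite divr_ge0// ltW.
have K1 : 1 <= K by rewrite /K; lra.
have se := subexponential_expR (2 * p : R).
pose D : R := expR (2 * p * K) * \int[gam]_x expR (2 * p * `|x|).
have D0 : 0 <= D.
  rewrite mulr_ge0 ?expR_ge0//.
  by apply: gauss_Rintegral_ge0 => x; exact: expR_ge0.
exists D => // t.
have sw := subexponential_spread t p0.
have [tK|tK] := leP `|t| K.
  apply: (@le_trans _ _ D); last by rewrite lerDr mulr_ge0 ?sqr_ge0 ?ltW.
  rewrite /D -gauss_RintegralZ//; apply: gauss_le_Rintegral => //.
    exact: subexponentialZ.
  move=> x.
  have h1 : `|t + x| `^ p <= expR (p * K) * expR (p * `|x|).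
    rewrite (le_trans (powR_norm_le_expR _ p0))// -expRD ler_expR -mulrDr.
    rewrite ler_pM2l// (le_trans (ler_normD _ _))//.
    by rewrite lerD2r.
  have h2 : `|t| `^ p <= expR (p * K) * expR (p * `|x|).
    rewrite (le_trans (powR_norm_le_expR _ p0))// -expRD ler_expR -mulrDr.
    by rewrite ler_pM2l//; have := normr_ge0 x; lra.
  have h3 := powR_ge0 `|t + x| p; have h4 := powR_ge0 `|t| p.
  have -> : expR (2 * p * K) * expR (2 * p * `|x|) =
    (expR (p * K) * expR (p * `|x|)) ^+ 2.
    by rewrite expr2 -!expRD; congr expR; ring.
  rewrite -[leLHS]ger0_norm ?sqr_ge0// normrX lerXn2r ?nnegrE//.
  rewrite ler_norml; apply/andP; split; lra.
have t1 : 1 < `|t| by exact: le_lt_trans K1 tK.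
have tp := powR_ge0 `|t| p.
rewrite g_large//; apply: (@le_trans _ _ (del * (`|t| `^ p) ^+ 2)); last by lra.
have sa := subexponential_expR a.
apply: (@le_trans _ _ ((`|t| `^ p / `|t|) ^+ 2 * M)).
  rewrite /M mulrA -gauss_RintegralZ//; apply: gauss_le_Rintegral => //.
    exact: subexponentialZ.
  move=> x; have h := powR_normD_sub_le x p0 (ltW t1).
  rewrite -[leLHS]ger0_norm ?sqr_ge0// normrX.
  have -> : (`|t| `^ p / `|t|) ^+ 2 * (2 * p + 4) ^+ 2 * expR (a * `|x|) =
    ((2 * p + 4) * (`|t| `^ p / `|t|) * expR ((2 * p + 1) * `|x|)) ^+ 2.
    by rewrite /a [(_ + _) * `|x|]mulrDl expRD; ring.
  by rewrite lerXn2r// ?nnegrE// (le_trans _ h).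
rewrite exprMn [leRHS]mulrC -mulrA ler_wpM2l ?sqr_ge0//.
rewrite exprVn ler_pdivrMl; last by rewrite exprn_gt0// (lt_trans ltr01).
have tM : M / del <= `|t| by rewrite /K in tK; lra.
rewrite ler_pdivrMr// in tM.
have : `|t| <= `|t| ^+ 2 by rewrite expr2 ler_peMr// ltW.
move=> h; apply: (le_trans tM); rewrite ler_wpM2r// ltW//.
Qed.

(** With [q] the tail probability, for [|t| <= 1] the tail event forces
    [|t + x|^p >= moment p 0 + 1], so its contribution exceeds [q * moment p 0] by at least [q];
    replacing [moment p 0] by [moment p t] costs a multiple of [q * g_p(t)]. For [|t| > 1] one has
    [g_p(t) >= 1], and nonnegativity of the tail contribution suffices. *)
Lemma tail_correlation_ge p : 0 < p ->
  exists A C : R, [/\ 0 <= A, 0 <= C & forall t,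
    gauss_tail A * (1 - C * g_ p t) <=
    \int[gam]_x ((\1_(tail_set A) x - gauss_tail A) * `|t + x| `^ p)].
Proof.
move=> p0.
have combine (q m D g I mt : R) : q * mt <= q * (m + D * g) ->
  q * (m + 1) * (1 - g) <= I -> q * (1 - (D + m + 1) * g) <= I - q * mt by lra.
have shift (b t x : R) : `|t| <= 1 -> 1 + b <= `|x| -> b <= `|t + x|.
  by have := ler_normB (t + x) t; rewrite addrAC subrr add0r; lra.
have [C C0 mC] := moment_le p0.
have m0 := @moment_ge0 R p 0.
(* The tail threshold will be [1 + B]: a shift by at most 1 still leaves [|t + x| >= B]. *)
have [B B0 Bp] : exists2 B : R, 0 <= B & B `^ p = moment p 0 + 1.
  exists ((moment p 0 + 1) `^ p^-1); first exact: powR_ge0.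
  by rewrite -powRrM mulVf ?gt_eqF// powRr1//; lra.
exists (1 + B), (C + moment p 0 + 1); split; [lra|lra|] => t.
pose q := gauss_tail (1 + B).
have q0 : 0 < q by apply: gauss_tail_gt0; lra.
have st := @subexponential_tail R (1 + B).
have sp := @subexponential_powR R p p0 t.
have -> : \int[gam]_x ((\1_(tail_set (1 + B)) x - q) * `|t + x| `^ p) =
  \int[gam]_x (\1_(tail_set (1 + B)) x * `|t + x| `^ p) - q * moment p t.
  rewrite -gauss_RintegralZ// -gauss_RintegralB//.
  - by apply: eq_Rintegral => x _; rewrite mulrBl.
  - exact: subexponentialM.
  - exact: subexponentialZ.
have g0 := g_ge0 p t.
have qm : q * moment p t <= q * (moment p 0 + C * g_ p t) by rewrite ler_pM2l.
suff : q * (moment p 0 + 1) * (1 - g_ p t) <=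
    \int[gam]_x (\1_(tail_set (1 + B)) x * `|t + x| `^ p).
  exact: combine qm.
have qm0 : 0 <= q * (moment p 0 + 1) by rewrite mulr_ge0 ?addr_ge0// ltW.
have [t1|t1] := leP `|t| 1; last first.
  apply: (@le_trans _ _ 0); last first.
    by apply: gauss_Rintegral_ge0 => x; rewrite mulr_ge0 ?powR_ge0.
  by rewrite mulr_ge0_le0// subr_le0 g_large// powR_norm_ge1// ltW.
apply: (@le_trans _ _ (q * (moment p 0 + 1))).
  by rewrite ler_piMr// gerBl.
rewrite mulrC /q -gauss_RintegralZ//; apply: gauss_le_Rintegral.
- exact: subexponentialZ.
- exact: subexponentialM.
move=> x; rewrite [leRHS]mulrC indicE.
case: (boolP (_ \in _)) => [/set_mem|_]; last by rewrite !mulr0.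
rewrite /tail_set/= => xB; rewrite !mulr1 -Bp.
apply: ge0_ler_powR; rewrite ?nnegrE ?(ltW p0)//.
exact: shift t1 xB.
Qed.

End spread.

(** * Expectations of products of independent variables *)

Lemma indic_bigI_prod {R : realType} {T : Type} n (B : nat -> set T) (w : T) :
  \prod_(i < n) (\1_(B i) w : R) = \1_(\bigcap_(j in `I_n) B j) w.
Proof.
rewrite indicE; case: (boolP (_ \in _)) => [/set_mem wB|/negP wB].
  by rewrite big1// => i _; rewrite indicE mem_set//; exact/wB/(ltn_ord i).
apply/eqP/negPn/negP => /prodf_neq0 h; apply: wB; apply/mem_set => j jn.
have := h (Ordinal (jn : (j < n)%N)) isT; rewrite indicE /=.
by case: (boolP (w \in B j)) => [/set_mem//|]; rewrite eqxx.
Qed.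

Section product_expectation.
Context {d : measure_display} {T : measurableType d} {R : realType}
  (P : probability T R).
Local Notation gam := (normal_prob (0 : R) 1).
Variable eps : nat -> {RV P >-> R}.
Hypothesis heps : iid_standard_normal eps.

Let meps i : measurable_fun setT (eps i). Proof. by []. Qed.

Lemma iid_probability (i : nat) (B : set R) : measurable B ->
  P (eps i @^-1` B) = gam B.
Proof. by move=> mB; have [_ /(_ i B mB)] := heps. Qed.

Lemma iid_probability_bigcap n (B : nat -> set R) : (forall i, measurable (B i)) ->
  P (\bigcap_(j in `I_n) (eps j @^-1` B j)) = (\prod_(i < n) gam (B i))%E.
Proof.
move=> mB; pose J := seq_fset tt (iota 0 n).
have JE : [set` J] = `I_n.
  by apply/seteqP; split=> j /=; rewrite seq_fsetE mem_iota.
have [+ _] := heps; move=> /(_ J B mB); rewrite JE => ->.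
rewrite (perm_big (iota 0 n)) /=; last first.
  apply: uniq_perm; [exact: (fset_uniq J)|exact: iota_uniq|].
  by move=> j; rewrite (seq_fsetE tt (iota 0 n) j).
rewrite -[n in iota 0 n]subn0 big_mkord.
by apply: eq_bigr => i _; rewrite iid_probability.
Qed.

Lemma gauss_fineK (F : R -> R) : subexponential F ->
  (\int[gam]_x F x)%:E = (\int[gam]_x (F x)%:E)%E.
Proof.
move=> sF; rewrite fineK//.
exact: integrable_fin_num (subexponential_integrable sF).
Qed.

Lemma gauss_indic (B : set R) : measurable B ->
  gam B = (\int[gam]_x (\1_B x : R))%:E.
Proof.
move=> mB; rewrite gauss_fineK; last exact: subexponential_indic.
by rewrite integral_indic// setIT.
Qed.

Lemma expectation_prod n (f : nat -> R -> R) :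
  (forall i, subexponential (f i)) -> (forall i x, 0 <= f i x) ->
  (\int[P]_w (\prod_(i < n) f i (eps i w))%:E =
   (\prod_(i < n) \int[gam]_x f i x)%:E)%E.
Proof.
(* The factors are replaced by arbitrary functions one at a time, starting
   from the case where all of them are indicators. *)
suff main k : forall f : nat -> R -> R,
    (forall i, subexponential (f i)) -> (forall i x, 0 <= f i x) ->
    (forall i, (k <= i < n)%N -> exists2 B, measurable B & f i = \1_B) ->
    (\int[P]_w (\prod_(i < n) f i (eps i w))%:E =
    (\prod_(i < n) \int[gam]_x f i x)%:E)%E.
  move=> sf f0; apply: (main n) => // i /andP[ni].
  by rewrite ltnNge ni.
elim: k => [|k ih] {}f sf f0 fB.
  (* Beyond [n] the product never consults [B]; [set0] is only a measurable default. *)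
  have /choice[B BP] : forall i, exists B, measurable B /\ ((i < n)%N -> f i = \1_B).
    move=> i; have [ni|ni] := ltnP i n.
      by have [B mB fE] := fB i ni; exists B; split.
    by exists set0; split.
  transitivity (\int[P]_w (\1_(\bigcap_(j in `I_n) (eps j @^-1` B j)) w)%:E)%E.
    apply: eq_integral => w _; rewrite -indic_bigI_prod; congr EFin.
    by apply: eq_bigr => i _; rewrite (BP i).2.
  rewrite integral_indic//; last first.
    apply: bigcap_measurableType => i _.
    by rewrite -[X in measurable X]setTI; apply: meps => //; exact: (BP i).1.
  rewrite setIT; transitivity (\prod_(i < n) gam (B i))%E.
    by apply: iid_probability_bigcap => i; exact: (BP i).1.
  rewrite -prodEFin; apply: eq_bigr => i _.
  by rewrite gauss_indic ?(BP i).2//; exact: (BP i).1.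
have [kn|nk] := ltnP k n; last first.
  apply: ih => // i /andP[ki iN].
  by move: (leq_ltn_trans ki iN); rewrite ltnNge nk.
pose kk : 'I_n := Ordinal kn.
pose g := fun B i => if i == k then \1_B else f i : R -> R.
pose G := fun w => \prod_(i < n | i != kk) f i (eps i w).
pose c := \prod_(i < n | i != kk) \int[gam]_x f i x.
have gE B (i : 'I_n) : i != kk -> g B i = f i.
  by move=> /negPf ik; rewrite /g; case: eqP => // ik'; rewrite -val_eqE /= ik' eqxx in ik.
have gk B : g B kk = \1_B by rewrite /g eqxx.
have sg B : measurable B -> forall i, subexponential (g B i).
  by move=> mB i; rewrite /g; case: eqP => // _; exact: subexponential_indic.
have g0 B i x : 0 <= g B i x.
  by rewrite /g; case: eqP => // _; rewrite indicE.
(* With an indicator in position [k] the induction hypothesis applies. It yields exactly the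
   assumption of [weighted_transfer], which then puts the original [f k] back. *)
have IH B : measurable B ->
    (\int[P]_w ((\1_B (eps k w))%:E * (G w)%:E) = c%:E * gam B)%E.
  move=> mB.
  transitivity (\int[P]_w (\prod_(i < n) g B i (eps i w))%:E)%E.
    apply: eq_integral => w _; rewrite -EFinM; congr EFin.
    rewrite (bigD1 kk)//= gk; congr (_ * _).
    by apply: eq_bigr => i ik; rewrite gE.
  rewrite (ih (g B))//; last 2 first.
  - exact: sg.
  - move=> i /andP[ki iN]; rewrite /g; case: eqP => [_|/eqP ik].
      by exists B.
    by apply: fB; rewrite iN ltn_neqAle eq_sym ik ki.
  rewrite (bigD1 kk)//= gk mulrC EFinM -gauss_indic//; congr (_ * _)%E.
  by congr EFin; apply: eq_bigr => i ik; rewrite gE.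
have mG : measurable_fun setT G.
  rewrite /G; under eq_fun do rewrite big_mkcond/=.
  apply: measurable_prod => i _; case: (i != kk) => //.
  exact: (measurableT_comp (sf i).1 (meps i)).
have G0 w : 0 <= G w by apply: prodr_ge0.
have c0 : 0 <= c by apply: prodr_ge0 => i _; apply: gauss_Rintegral_ge0.
transitivity (\int[P]_w ((f k (eps k w))%:E * (G w)%:E))%E.
  by apply: eq_integral => w _; rewrite (bigD1 kk).
rewrite (@weighted_transfer _ _ _ _ _ P gam (eps k) G c)//; last exact: (sf k).1.
- rewrite [in RHS](bigD1 kk)//= [in RHS]mulrC EFinM; congr (_ * _)%E.
  by rewrite gauss_fineK.
- exact: meps.
Qed.

End product_expectation.

(** * Weighted second moments *)

Lemma Rintegral_sum {d : measure_display} {T : measurableType d} {R : realType}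
    (mu : {measure set T -> \bar R}) (I : Type) (s : seq I) (F : I -> T -> R) :
  (forall i, mu.-integrable setT (EFin \o F i)) ->
  \int[mu]_w (\sum_(i <- s) F i w) = \sum_(i <- s) \int[mu]_w F i w.
Proof.
move=> iF; elim: s => [|i s ih].
  by under eq_Rintegral do rewrite big_nil; rewrite big_nil Rintegral_cst// mul0r.
under eq_Rintegral do rewrite big_cons.
rewrite RintegralD//; first by rewrite ih big_cons.
have : mu.-integrable setT (fun w => \sum_(i <- s) (F i w)%:E)%E.
  by apply: integrable_sum => // j _; exact: iF.
by apply: eq_integrable => // w _; rewrite /= sumEFin.
Qed.

Section weighted_chebyshev.
Context {d : measure_display} {T : measurableType d} {R : realType}
  (P : probability T R).
Local Notation gam := (normal_prob (0 : R) 1).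
Variable eps : nat -> {RV P >-> R}.
Hypothesis heps : iid_standard_normal eps.

Lemma measurable_sum_eps n (y : nat -> R -> R) : (forall i, subexponential (y i)) ->
  measurable_fun setT (fun w => \sum_(i < n) y i (eps i w)).
Proof.
move=> sy; apply: measurable_sum => i.
by apply: (measurableT_comp (sy i).1).
Qed.

Lemma measurable_prod_eps n (f : nat -> R -> R) : (forall i, subexponential (f i)) ->
  measurable_fun setT (fun w => \prod_(i < n) f i (eps i w)).
Proof.
move=> sf; apply: measurable_prod => i _.
by apply: (measurableT_comp (sf i).1).
Qed.

Lemma integrable_prod_eps n (f : nat -> R -> R) :
  (forall i, subexponential (f i)) -> (forall i x, 0 <= f i x) ->
  P.-integrable setT (EFin \o (fun w => \prod_(i < n) f i (eps i w))).
Proof.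
move=> sf f0; apply/integrableP; split.
  by apply/measurable_EFinP; exact: measurable_prod_eps.
under eq_integral => w _ do rewrite /= ger0_norm ?prodr_ge0//.
by rewrite (expectation_prod heps)// ltry.
Qed.

Lemma Rintegral_prod_eps n (f : nat -> R -> R) :
  (forall i, subexponential (f i)) -> (forall i x, 0 <= f i x) ->
  \int[P]_w (\prod_(i < n) f i (eps i w)) = \prod_(i < n) \int[gam]_x f i x.
Proof. by move=> sf f0; rewrite /Rintegral (expectation_prod heps). Qed.

Section weight.
Variables (n : nat) (l : R -> R) (y : nat -> R -> R).
Hypotheses (sl : subexponential l) (l0 : forall x, 0 <= l x).
Hypothesis l1 : \int[gam]_x l x = 1.
Hypotheses (sy : forall i, subexponential (y i)) (y0 : forall i x, 0 <= y i x).

Definition weight (w : T) : R := \prod_(i < n) l (eps i w).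
Definition weighted_mean (i : nat) : R := \int[gam]_x (l x * y i x).

(** Writes the weighted product of two summands as one product over all coordinates, so that
    [expectation_prod] applies. For [i = j] both conditionals act on the same coordinate and produce
    the square. *)
Let pair_factor (i j : 'I_n) (k : nat) (x : R) : R :=
  l x * ((if k == i then y i x else 1) * (if k == j then y j x else 1)).

Let sfac (i j : 'I_n) k : subexponential (pair_factor i j k).
Proof.
apply: subexponentialM => //; apply: subexponentialM.
  by case: (k == i) => //; exact: subexponential_cst.
by case: (k == j) => //; exact: subexponential_cst.
Qed.

Let fac0 (i j : 'I_n) k x : 0 <= pair_factor i j k x.
Proof. by rewrite !mulr_ge0//; case: ifP. Qed.

Let prod_if (i : 'I_n) (F : 'I_n -> R) :
  \prod_(k < n) (if k == i :> nat then F k else 1) = F i.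
Proof. by rewrite -big_mkcond/= (big_pred1 i). Qed.

Let pairE (i j : 'I_n) w : weight w * (y i (eps i w) * y j (eps j w)) =
  \prod_(k < n) pair_factor i j k (eps k w).
Proof.
rewrite /pair_factor !big_split/=; congr (_ * (_ * _)).
  rewrite -[LHS](prod_if i (fun k => y i (eps k w))).
  by [].
by rewrite -[LHS](prod_if j (fun k => y j (eps k w))).
Qed.

Lemma integrable_weight_pair (i j : 'I_n) :
  P.-integrable setT (EFin \o (fun w => weight w * (y i (eps i w) * y j (eps j w)))).
Proof.
under [X in EFin \o X]eq_fun do rewrite pairE.
by apply: integrable_prod_eps => [k|k x]; [exact: sfac|exact: fac0].
Qed.

Lemma Rintegral_weight_pair (i j : 'I_n) :
  \int[P]_w (weight w * (y i (eps i w) * y j (eps j w))) =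
  if i == j then \int[gam]_x (l x * y i x ^+ 2)
  else weighted_mean i * weighted_mean j.
Proof.
under eq_Rintegral do rewrite pairE.
rewrite Rintegral_prod_eps; [|exact: sfac|exact: fac0].
rewrite (bigD1 i)//=; case: eqVneq => [<-|ij].
  rewrite big1 ?mulr1.
    by apply: eq_Rintegral => x _; rewrite /pair_factor eqxx.
  move=> k /negPf ki; rewrite -[RHS]l1; apply: eq_Rintegral => x _.
  by rewrite /pair_factor val_eqE ki !mulr1.
rewrite (bigD1 j) 1?eq_sym//= big1 ?mulr1 => [|k /andP[/negPf ki /negPf kj]].
  congr (_ * _); apply: eq_Rintegral => x _; rewrite /pair_factor eqxx !val_eqE.
    by rewrite (negPf ij) mulr1.
  by rewrite eq_sym (negPf ij) mul1r.
rewrite -[RHS]l1; apply: eq_Rintegral => x _.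
by rewrite /pair_factor !val_eqE ki kj !mulr1.
Qed.

Lemma integrable_weight : P.-integrable setT (EFin \o weight).
Proof. exact: (@integrable_prod_eps n (fun=> l)). Qed.

Lemma Rintegral_weight : \int[P]_w weight w = 1.
Proof. by rewrite /weight (@Rintegral_prod_eps n (fun=> l))// big1. Qed.

Let prod_if1 (i : 'I_n) (F : 'I_n -> R) w :
  weight w * F i = \prod_(k < n) (l (eps k w) * (if k == i :> nat then F k else 1)).
Proof. by rewrite big_split/= prod_if. Qed.

Let sfac1 (i : 'I_n) (k : nat) :
  subexponential (fun x => l x * (if k == i :> nat then y k x else 1)).
Proof.
apply: subexponentialM => //; case: (k == i :> nat) => //; exact: subexponential_cst.
Qed.

Let fac10 (i : 'I_n) (k : nat) x : 0 <= l x * (if k == i :> nat then y k x else 1).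
Proof. by rewrite mulr_ge0//; case: ifP. Qed.

Lemma integrable_weight_one (i : 'I_n) :
  P.-integrable setT (EFin \o (fun w => weight w * y i (eps i w))).
Proof.
under [X in EFin \o X]eq_fun => w do
  rewrite (prod_if1 i (fun k => y k (eps k w))).
exact: (integrable_prod_eps n (sfac1 i) (fac10 i)).
Qed.

Lemma Rintegral_weight_one (i : 'I_n) :
  \int[P]_w (weight w * y i (eps i w)) = weighted_mean i.
Proof.
under eq_Rintegral => w _ do rewrite (prod_if1 i (fun k => y k (eps k w))).
rewrite (Rintegral_prod_eps n (sfac1 i) (fac10 i)) (bigD1 i)//=.
rewrite big1 ?mulr1 => [|k /negPf ki].
  by apply: eq_Rintegral => x _; rewrite eqxx.
by rewrite -[RHS]l1; apply: eq_Rintegral => x _; rewrite val_eqE ki mulr1.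
Qed.

Let S w := \sum_(i < n) y i (eps i w).
Let b := \sum_(i < n) weighted_mean i.

(** The expansion of [weight * (y_i - m_i) * (y_j - m_j)], with [m_i] the weighted means, into terms
    whose integrals are already known. *)
Let cross (i j : 'I_n) w :=
  weight w * (y i (eps i w) * y j (eps j w)) -
  weighted_mean i * (weight w * y j (eps j w)) -
  weighted_mean j * (weight w * y i (eps i w)) +
  weighted_mean i * weighted_mean j * weight w.

Let integrableZ (c : R) (F : T -> R) : P.-integrable setT (EFin \o F) ->
  P.-integrable setT (EFin \o (fun w => c * F w)).
Proof.
move=> iF; have := integrableZl measurableT c iF.
by apply: eq_integrable => // w _; rewrite /= EFinM.
Qed.

Let integrableB' (F G : T -> R) : P.-integrable setT (EFin \o F) ->
  P.-integrable setT (EFin \o G) ->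
  P.-integrable setT (EFin \o (fun w => F w - G w)).
Proof.
move=> iF iG; have := integrableB measurableT iF iG.
by apply: eq_integrable => // w _; rewrite /= EFinB.
Qed.

Let integrableD' (F G : T -> R) : P.-integrable setT (EFin \o F) ->
  P.-integrable setT (EFin \o G) ->
  P.-integrable setT (EFin \o (fun w => F w + G w)).
Proof.
move=> iF iG; have := integrableD measurableT iF iG.
by apply: eq_integrable => // w _; rewrite /= EFinD.
Qed.

Let integrable_cross i j : P.-integrable setT (EFin \o cross i j).
Proof.
apply: integrableD'; last exact/integrableZ/integrable_weight.
apply: integrableB'; last exact/integrableZ/integrable_weight_one.
apply: integrableB'; last exact/integrableZ/integrable_weight_one.
exact: integrable_weight_pair.
Qed.

Let Rintegral_cross (i j : 'I_n) : \int[P]_w cross i j w =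
  if i == j then \int[gam]_x (l x * y i x ^+ 2) - weighted_mean i ^+ 2 else 0.
Proof.
have i1 := integrable_weight_one; have i2 := integrable_weight.
rewrite /cross RintegralD//; last exact: integrableZ; last first.
  apply: integrableB'; last exact: integrableZ.
  by apply: integrableB'; [exact: integrable_weight_pair|exact: integrableZ].
rewrite RintegralB//; last exact: integrableZ; last first.
  by apply: integrableB'; [exact: integrable_weight_pair|exact: integrableZ].
rewrite RintegralB//; last exact: integrableZ; last exact: integrable_weight_pair.
rewrite !RintegralZl// Rintegral_weight_pair !Rintegral_weight_one Rintegral_weight.
case: eqVneq => [->|_]; ring.
Qed.

(** Under the product density the coordinates remain independent, each with density [l], so the
    off-diagonal [cross] terms integrate to 0 and the variances add up. *)
Lemma weighted_variance :
  \int[P]_w (weight w * (S w - b) ^+ 2) =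
  \sum_(i < n) (\int[gam]_x (l x * y i x ^+ 2) - weighted_mean i ^+ 2) /\
  P.-integrable setT (EFin \o (fun w => weight w * (S w - b) ^+ 2)).
Proof.
have E w : weight w * (S w - b) ^+ 2 = \sum_(i < n) \sum_(j < n) cross i j w.
  rewrite /S /b -sumrB expr2 big_distrlr/= mulr_sumr; apply: eq_bigr => i _.
  by rewrite mulr_sumr; apply: eq_bigr => j _; rewrite /cross; ring.
have iS i : P.-integrable setT (EFin \o (fun w => \sum_(j < n) cross i j w)).
  have : P.-integrable setT (fun w => \sum_(j < n) (cross i j w)%:E)%E.
    by apply: integrable_sum => // j _; exact: integrable_cross.
  by apply: eq_integrable => // w _; rewrite /= sumEFin.
split; last first.
  have : P.-integrable setT (fun w => \sum_(i < n) (\sum_(j < n) cross i j w)%:E)%E.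
    by apply: integrable_sum => // i _; exact: iS.
  by apply: eq_integrable => // w _; rewrite /= E sumEFin.
under eq_Rintegral do rewrite E.
rewrite Rintegral_sum//; apply: eq_bigr => i _.
rewrite Rintegral_sum; last exact: integrable_cross.
rewrite (bigD1 i)//= big1 ?addr0 => [|j /negPf ji]; rewrite Rintegral_cross.
  by rewrite eqxx.
by rewrite eq_sym ji.
Qed.

(** Chebyshev's inequality for the reweighted law. The centres [a i] are free; they will be taken to
    be [|theta_i|^p], which brings in [spread]. *)
Lemma weighted_chebyshev (a : nat -> R) (s : R) (A : set T) : 0 < s ->
  measurable A -> (forall w, A w -> s <= `|S w - b|) ->
  \int[P]_w (weight w * \1_A w) <=
  (\sum_(i < n) \int[gam]_x (l x * (y i x - a i) ^+ 2)) / s ^+ 2.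
Proof.
move=> s0 mA AS.
have s2 : 0 < s ^+ 2 by rewrite exprn_gt0.
have W0 w : 0 <= weight w by exact: prodr_ge0.
have [V iV] := weighted_variance.
have iA : P.-integrable setT (EFin \o (fun w => weight w * \1_A w)).
  apply: le_integrable integrable_weight => //.
    apply/measurable_EFinP; apply: measurable_funM.
      exact: (measurable_prod_eps n (fun=> sl)).
    exact: measurable_indic.
  move=> w _ /=; rewrite lee_fin normrM ler_piMr// indicE.
  by case: (_ \in _); rewrite ?normr1 ?normr0.
rewrite ler_pdivlMr//.
apply: (@le_trans _ _ (\int[P]_w (weight w * (S w - b) ^+ 2))).
  rewrite -RintegralZr//; apply: le_Rintegral => //.
    have := integrableZ (s ^+ 2) iA.
    by apply: eq_integrable => // w _; rewrite /= mulrC.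
  move=> w _; rewrite -mulrA ler_wpM2l// indicE.
  case: (boolP (w \in A)) => [/set_mem/AS h|_]; last by rewrite mul0r sqr_ge0.
  rewrite mul1r -[leRHS]ger0_norm ?sqr_ge0// normrX lerXn2r// ?nnegrE//.
  exact: ltW.
rewrite V; apply: ler_sum => i _.
have s1 : subexponential (fun x => l x * y i x ^+ 2).
  by apply: subexponentialM => //; exact: subexponentialX.
have s3 : subexponential (fun x => l x * y i x) by exact: subexponentialM.
have -> : \int[gam]_x (l x * (y i x - a i) ^+ 2) =
    \int[gam]_x (l x * y i x ^+ 2) - 2 * a i * weighted_mean i + a i ^+ 2.
  transitivity (\int[gam]_x (l x * y i x ^+ 2 - 2 * a i * (l x * y i x)
      + a i ^+ 2 * l x)).
    by apply: eq_Rintegral => x _; ring.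
  have s4 := subexponentialZ (2 * a i) s3.
  rewrite gauss_RintegralD//; last exact: subexponentialZ; last exact: subexponentialB.
  by rewrite gauss_RintegralB// !gauss_RintegralZ// l1 mulr1.
(* This square is exactly the second moment about [a i] minus the variance. *)
have := sqr_ge0 (weighted_mean i - a i).
move: (weighted_mean i) (a i) (Rintegral _ _ _) => p q r; nra.
Qed.

End weight.
End weighted_chebyshev.

(** Turns the coordinatewise terms [g_p^2] of [spread_le] into the square of the total, the scale of
    the shift of the mean. *)
Lemma sumr_sqr_le_sqr_sumr {R : realDomainType} n (F : nat -> R) :
  (forall i, 0 <= F i) -> \sum_(i < n) F i ^+ 2 <= (\sum_(i < n) F i) ^+ 2.
Proof.
move=> F0; elim: n => [|n ih]; first by rewrite !big_ord0 expr0n.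
rewrite !big_ord_recr/= sqrrD (le_trans (lerD ih (lexx _)))//.
by rewrite -addrA lerD2l lerDr mulrn_wge0// mulr_ge0// sumr_ge0.
Qed.

(** * Comparing probabilities under the original and the reweighted law *)

Section change_of_measure.
Context {d : measure_display} {T : measurableType d} {R : realType}
  (P : probability T R).
Local Notation gam := (normal_prob (0 : R) 1).
Variable eps : nat -> {RV P >-> R}.
Hypothesis heps : iid_standard_normal eps.

Lemma Rintegral_indic (A : set T) : measurable A -> \int[P]_w (\1_A w) = fine (P A).
Proof. by move=> mA; rewrite /Rintegral integral_indic// setIT. Qed.

(* AM-GM: [L <= L^2 / (4 V) + V] *)
Lemma probability_ge_of_weight n (l : R -> R) (V : R) (A : set T) :
  subexponential l -> (forall x, 0 <= l x) -> \int[gam]_x l x = 1 ->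
  0 < V -> (\int[gam]_x (l x ^+ 2)) ^+ n <= V -> measurable A ->
  \int[P]_w (weight eps n l w * \1_(~` A) w) <= 2^-1 ->
  (4 * V)^-1 <= fine (P A).
Proof.
move=> sl l0 l1 V0 lV mA half.
have iW := integrable_weight heps n sl l0.
have W0 w : 0 <= weight eps n l w by exact: prodr_ge0.
have mW : measurable_fun setT (weight eps n l).
  exact: (@measurable_prod_eps _ _ _ _ eps n (fun=> l)).
have s2 : subexponential (fun x => l x ^+ 2) by exact: subexponentialX.
have l20 x : 0 <= l x ^+ 2 by rewrite sqr_ge0.
have iW2 : P.-integrable setT (EFin \o (fun w => weight eps n l w ^+ 2)).
  have := integrable_prod_eps heps n (fun=> s2) (fun=> l20).
  by apply: eq_integrable => // w _; rewrite /= prodrXl.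
have EW2 : \int[P]_w (weight eps n l w ^+ 2) <= V.
  rewrite (le_trans _ lV)// -[X in _ <= _ ^+ X]card_ord -prodr_const.
  rewrite -(Rintegral_prod_eps heps n (fun=> s2) (fun=> l20)).
  by under [leRHS]eq_Rintegral do rewrite prodrXl.
have iI (B : set T) : measurable B -> P.-integrable setT (EFin \o (\1_B : T -> R)).
  by move=> mB; apply: integrable_indic => //; rewrite ltey_eq fin_num_measure.
have iWI (B : set T) : measurable B ->
    P.-integrable setT (EFin \o (fun w => weight eps n l w * \1_B w)).
  move=> mB; apply: le_integrable iW => //.
    by apply/measurable_EFinP; apply: measurable_funM.
  move=> w _ /=; rewrite lee_fin normrM ler_piMr// indicE.
  by case: (_ \in _); rewrite ?normr1 ?normr0.
have mC : measurable (~` A) by exact: measurableC.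
have split1 : \int[P]_w (weight eps n l w * \1_A w) +
    \int[P]_w (weight eps n l w * \1_(~` A) w) = 1.
  rewrite -(Rintegral_weight heps n sl l0 l1) -RintegralD//; [|exact: iWI..].
  apply: eq_Rintegral => w _; rewrite !indicE in_setC.
  by case: (w \in A); rewrite /= ?mulr1 ?mulr0 ?addr0 ?add0r.
have upper : \int[P]_w (weight eps n l w * \1_A w) <=
    (4 * V)^-1 * \int[P]_w (weight eps n l w ^+ 2) + V * fine (P A).
  rewrite -Rintegral_indic// -!RintegralZl//; last exact: iI.
  have i1 : P.-integrable setT (EFin \o (fun w => (4 * V)^-1 * weight eps n l w ^+ 2)).
    by have := integrableZl measurableT ((4 * V)^-1) iW2.
  have i2 : P.-integrable setT (EFin \o (fun w => V * \1_A w)).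
    by have := integrableZl measurableT V (iI _ mA).
  rewrite -RintegralD//; apply: le_Rintegral => //.
  - exact: iWI.
  - by have := integrableD measurableT i1 i2.
  move=> w _; rewrite indicE; case: (_ \in _); rewrite /= ?mulr1 ?mulr0 ?addr0.
    move: (weight _ _ _ _) (W0 w) => L L0.
    have KV : (4 * V)^-1 * (4 * V) = 1 by rewrite mulVf// gt_eqF// mulr_gt0.
    have K0 : 0 <= (4 * V)^-1 by rewrite invr_ge0 mulr_ge0// ltW.
    (* The last summand is zero. It makes the identity true with any [K] in place of [(4 * V)^-1],
       so that [ring] can prove it. *)
    have -> : (4 * V)^-1 * L ^+ 2 + V = L + (4 * V)^-1 * (L - 2 * V) ^+ 2 +
      (1 - (4 * V)^-1 * (4 * V)) * (V - L) by move: (_^-1) => K; ring.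
    by rewrite KV subrr mul0r addr0 lerDl mulr_ge0// sqr_ge0.
  by rewrite mulr_ge0 ?sqr_ge0// invr_ge0 mulr_ge0// ltW.
have V4 : (4 * V)^-1 * \int[P]_w (weight eps n l w ^+ 2) <= 4^-1.
  rewrite (@le_trans _ _ ((4 * V)^-1 * V))//.
    by rewrite ler_wpM2l// invr_ge0 mulr_ge0// ltW.
  by rewrite invfM -mulrA mulVf ?mulr1// gt_eqF.
(* The event carries reweighted mass at least 1/2, of which the second moment of the weight accounts
   for at most 1/4. *)
have : 4^-1 <= V * fine (P A).
  move: half split1 upper V4; clear.
  move: (\int[P]_w (weight eps n l w * \1_A w)) => a.
  move: (\int[P]_w (weight eps n l w * \1_(~` A) w)) => a'.
  move: (_^-1 * _) (V * _) => u v; lra.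
by move=> h; rewrite invfM mulrC ler_pdivrMl.
Qed.

Variables (p : R) (p0 : 0 < p).

Definition score (n : nat) (th : nat -> R) (w : T) : R :=
  \sum_(i < n) `|th i + eps i w| `^ p.

Lemma measurable_score n th : measurable_fun setT (score n th).
Proof.
apply: (@measurable_sum_eps _ _ _ _ eps n (fun i x => `|th i + x| `^ p)) => i.
exact: subexponential_powR.
Qed.

Lemma measurable_score_ge n th (c : R) : measurable [set w | c <= score n th w].
Proof.
rewrite (_ : mkset _ = score n th @^-1` `[c, +oo[); last first.
  by apply/seteqP; split=> w /=; rewrite in_itv/= andbT.
by rewrite -[X in measurable X]setTI; exact: measurable_score.
Qed.

Lemma measurable_score_lt n th (c : R) : measurable [set w | score n th w < c].
Proof.
rewrite (_ : mkset _ = ~` [set w | c <= score n th w]).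
  exact/measurableC/measurable_score_ge.
by apply/seteqP; split=> w /=; rewrite ltNge; move/negP.
Qed.

(** The case [l = 1] of the weighted inequality, where the weight is constant. *)
Lemma score_chebyshev n th (s : R) (A : set T) : 0 < s -> measurable A ->
  (forall w, A w -> s <= `|score n th w - \sum_(i < n) moment p (th i)|) ->
  fine (P A) <= (\sum_(i < n) spread p (th i)) / s ^+ 2.
Proof.
move=> s0 mA AS.
have sy i := @subexponential_powR R p p0 (th i).
have y0 (i : nat) x : 0 <= `|th i + x| `^ p by exact: powR_ge0.
pose y (i : nat) (x : R) : R := `|th i + x| `^ p.
have E : \sum_(i < n) weighted_mean (fun=> 1) y i = \sum_(i < n) moment p (th i).
  apply: eq_bigr => i _; rewrite /weighted_mean.
  by apply: eq_Rintegral => x _; rewrite mul1r.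
have AS' w : A w ->
    s <= `|score n th w - \sum_(i < n) weighted_mean (fun=> 1) y i|.
  by rewrite E; exact: AS.
have := weighted_chebyshev heps (subexponential_cst 1) (fun=> ler01)
  (gauss_Rintegral_cst 1) sy y0 (fun i => `|th i| `^ p) s0 mA AS'.
have -> : \int[P]_w (weight eps n (fun=> 1) w * \1_A w) = fine (P A).
  rewrite -Rintegral_indic//; apply: eq_Rintegral => w _.
  by rewrite /weight big1// mul1r.
move=> /le_trans; apply; rewrite ler_wpM2r ?invr_ge0 ?sqr_ge0//.
by apply: ler_sum => i _; rewrite /spread; under eq_Rintegral do rewrite mul1r.
Qed.

End change_of_measure.

(** * Tilting *)

Section tilt.
Context {R : realType}.
Local Notation gam := (normal_prob (0 : R) 1).
Variable A : R.
Hypothesis A0 : 0 <= A.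

Definition tilt (r x : R) : R := 1 - r * (\1_(tail_set A) x - gauss_tail A).

Let q := gauss_tail A.
Let st := @subexponential_tail R A.
Let sc (c : R) := subexponential_cst c.

Let q0 : 0 < q. Proof. exact: gauss_tail_gt0. Qed.

Let q1 : q <= 1.
Proof.
rewrite /q /gauss_tail -[leRHS]gauss_Rintegral_cst.
by apply: gauss_le_Rintegral => // x; rewrite indicE lern1 leq_b1.
Qed.

Let centered_le1 x : `|\1_(tail_set A) x - q| <= 1.
Proof.
rewrite indicE ler_norml; case: (_ \in _) => /=.
  by move: q0 q1 => *; apply/andP; split; lra.
by move: q0 q1 => *; apply/andP; split; lra.
Qed.

Lemma subexponential_tilt r : subexponential (tilt r).
Proof.
by apply: subexponentialB => //; apply: subexponentialZ; exact: subexponentialB.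
Qed.

Lemma tilt_ge0 r x : 0 <= r <= 1 -> 0 <= tilt r x.
Proof.
move=> /andP[r0 r1]; rewrite /tilt subr_ge0 -[leRHS]mulr1.
have := centered_le1 x; rewrite -/q ler_norml => /andP[_ h].
rewrite mulr1 (le_trans (ler_wpM2l r0 h))// mulr1//.
Qed.

Lemma tilt_le2 r x : 0 <= r <= 1 -> tilt r x <= 2.
Proof.
move=> /andP[r0 r1]; rewrite /tilt -/q.
have := centered_le1 x; rewrite ler_norml => /andP[h _].
have := ler_wpM2l r0 h; lra.
Qed.

Lemma Rintegral_centered : \int[gam]_x (\1_(tail_set A) x - q) = 0.
Proof. by rewrite gauss_RintegralB// gauss_Rintegral_cst subrr. Qed.

Lemma Rintegral_tilt r : \int[gam]_x tilt r x = 1.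
Proof.
have sB := subexponentialB st (sc q).
rewrite /tilt gauss_RintegralB//; last exact: subexponentialZ.
by rewrite gauss_RintegralZ// Rintegral_centered mulr0 subr0 gauss_Rintegral_cst.
Qed.

Lemma Rintegral_tilt_sqr r : \int[gam]_x (tilt r x ^+ 2) <= 1 + r ^+ 2.
Proof.
have sB := subexponentialB st (sc q).
have s2 := subexponentialX 2 sB.
have -> : \int[gam]_x (tilt r x ^+ 2) =
    \int[gam]_x (1 - 2 * r * (\1_(tail_set A) x - q) +
                 r ^+ 2 * (\1_(tail_set A) x - q) ^+ 2).
  by apply: eq_Rintegral => x _; rewrite /tilt -/q; ring.
have sZ := subexponentialZ (2 * r) sB.
have sZ2 := subexponentialZ (r ^+ 2) s2.
rewrite gauss_RintegralD//; last exact: subexponentialB.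
rewrite gauss_RintegralB// !gauss_RintegralZ// Rintegral_centered.
rewrite gauss_Rintegral_cst mulr0 subr0 lerD2l ler_piMr ?sqr_ge0//.
rewrite -[leRHS]gauss_Rintegral_cst; apply: gauss_le_Rintegral => // x.
by rewrite -[leLHS]ger0_norm ?sqr_ge0// normrX exprn_ile1.
Qed.

(** Each factor has second moment at most [1 + s^2 / n <= exp (s^2 / n)]. *)
Lemma Rintegral_tilt_sqr_exp (n : nat) (s : R) : (0 < n)%N ->
  (\int[gam]_x (tilt (s / Num.sqrt n%:R) x ^+ 2)) ^+ n <= expR (s ^+ 2).
Proof.
move=> n0; have nR : 0 < n%:R :> R by rewrite ltr0n.
have -> : expR (s ^+ 2) = expR (s ^+ 2 / n%:R) ^+ n.
  by rewrite -expRM_natl mulrC divfK// gt_eqF.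
have I0 r : 0 <= \int[gam]_x (tilt r x ^+ 2).
  by apply: gauss_Rintegral_ge0 => x; rewrite sqr_ge0.
rewrite lerXn2r ?nnegrE ?expR_ge0//.
rewrite (le_trans (Rintegral_tilt_sqr _))// exprMn exprVn sqr_sqrtr ?(ltW nR)//.
exact: expR_ge1Dx.
Qed.

Lemma Rintegral_tilt_powR p r t : 0 < p ->
  \int[gam]_x (tilt r x * `|t + x| `^ p) = moment p t -
    r * \int[gam]_x ((\1_(tail_set A) x - q) * `|t + x| `^ p).
Proof.
move=> p0; have sp := @subexponential_powR R p p0 t.
have sB := subexponentialB st (sc q).
have sM := subexponentialM sB sp.
rewrite -gauss_RintegralZ// -gauss_RintegralB//; last exact: subexponentialZ.
by apply: eq_Rintegral => x _; rewrite /tilt -/q; ring.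
Qed.

Lemma Rintegral_tilt_spread p r t : 0 < p -> 0 <= r <= 1 ->
  \int[gam]_x (tilt r x * (`|t + x| `^ p - `|t| `^ p) ^+ 2) <= 2 * spread p t.
Proof.
move=> p0 r01; have ss := @subexponential_spread R p t p0.
rewrite /spread -gauss_RintegralZ//; apply: gauss_le_Rintegral.
- by apply: subexponentialM => //; exact: subexponential_tilt.
- exact: subexponentialZ.
by move=> x; rewrite ler_wpM2r ?sqr_ge0// tilt_le2.
Qed.

End tilt.

(** * Small scores keep a probability bounded below when the shifts are small in total *)

Section lower_deviation.
Context {d : measure_display} {T : measurableType d} {R : realType}
  (P : probability T R).
Local Notation gam := (normal_prob (0 : R) 1).
Variable eps : nat -> {RV P >-> R}.
Hypothesis heps : iid_standard_normal eps.

Lemma score_lower_deviation (p C M : R) : 0 < p -> 0 <= M ->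
  exists eta Y : R, 0 < eta /\ forall (n : nat) (th : nat -> R),
    (0 < n)%N -> Y <= Num.sqrt n%:R ->
    \sum_(i < n) g_ p (th i) <= M * Num.sqrt n%:R ->
    eta <= fine (P [set w | score eps p n th w <
                            n%:R * moment p 0 - C * Num.sqrt n%:R]).
Proof.
move=> p0 M0.
have arith (a b D c e : R) : a <= b * e -> 4 * (b + D) * e <= c * e ->
  2 * (a + D * e) <= 2^-1 * (c * e) by lra.
have [C1 C10 mle] := moment_le p0.
have [D D0 wle] := spread_le p0 ltr01.
have [A [C2 [A0 C20 cor]]] := tail_correlation_ge p0.
have q0 := gauss_tail_gt0 A0.
(* [E sqrt n] is the deviation fed to Chebyshev. The tilted variance is at most [2 (M^2 + D) n], the
   2 coming from [tilt_le2], and [E^2 >= 4 (M^2 + D)] brings the bound down to 1/2. *)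
pose E : R := 1 + 4 * (M ^+ 2 + D).
have MD0 : 0 <= M ^+ 2 + D by rewrite addr_ge0// sqr_ge0.
(* In units of [sqrt n] the tilt must offset the rise [C1 * M] of the mean due to [th], the required
   depth [C] and the deviation [E]; the final 1 pays for the loss term of [tail_correlation_ge]. *)
have [s s0 sE] : exists2 s : R, 0 <= s & C1 * M + C + E + 1 <= s * gauss_tail A.
  exists (`|C1 * M + C + E + 1| / gauss_tail A).
    by rewrite divr_ge0// ltW.
  by rewrite divfK ?gt_eqF// ler_norm.
(* The first summand of [Y] ensures [s / sqrt n <= 1], so that the tilt is nonnegative; the second
   ensures that the loss term is at most [sqrt n]. *)
exists (4 * expR (s ^+ 2))^-1, (s + s * gauss_tail A * C2 * M).
split; first by rewrite invr_gt0 mulr_gt0 ?expR_gt0.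
move=> n th n0 Yn Gn.
have nR : 0 < n%:R :> R by rewrite ltr0n.
pose S : R := Num.sqrt n%:R.
have S0 : 0 < S by rewrite sqrtr_gt0.
have SS : S ^+ 2 = n%:R by rewrite sqr_sqrtr// ltW.
have Y0 : 0 <= s * gauss_tail A * C2 * M by rewrite !mulr_ge0// ltW.
have sS : s <= S by rewrite (le_trans _ Yn)// lerDl.
have YS : s * gauss_tail A * C2 * M <= S by rewrite (le_trans _ Yn)// lerDr.
pose r := s / S.
have r01 : 0 <= r <= 1.
  by rewrite /r divr_ge0 ?(ltW S0)//= ler_pdivrMr// mul1r.
have st := @subexponential_tilt R A r.
have l0 x := @tilt_ge0 R A A0 r x r01.
have l1 := @Rintegral_tilt R A r.
have mlt := measurable_score_lt eps p0 n th (n%:R * moment p 0 - C * S).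
apply: (probability_ge_of_weight heps st l0 l1 _ _ mlt).
- exact: expR_gt0.
- exact: Rintegral_tilt_sqr_exp.
pose y (i : nat) (x : R) : R := `|th i + x| `^ p.
have sy i := @subexponential_powR R p p0 (th i).
have y0 (i : nat) x : 0 <= y i x by exact: powR_ge0.
have g0 i := g_ge0 p (th i).
pose G := \sum_(i < n) g_ p (th i).
have mean_le : \sum_(i < n) weighted_mean (tilt A r) y i <=
    n%:R * moment p 0 + C1 * G - r * (gauss_tail A * (n%:R - C2 * G)).
  have -> : n%:R * moment p 0 + C1 * G - r * (gauss_tail A * (n%:R - C2 * G)) =
    \sum_(i < n) (moment p 0 + C1 * g_ p (th i) -
      r * (gauss_tail A * (1 - C2 * g_ p (th i)))).
    rewrite sumrB big_split/= -!mulr_sumr sumrB -mulr_sumr !sumr_const card_ord.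
    by rewrite mulr_natl.
  apply: ler_sum => i _; rewrite /weighted_mean Rintegral_tilt_powR//.
  apply: lerB => //; apply: ler_wpM2l; last exact: cor.
  by case/andP: r01.
have Sbound : 0 < E * S.
  by rewrite mulr_gt0// /E; move: MD0; move: (M ^+ 2 + D) => z; lra.
have dev w : (~` [set w | score eps p n th w < n%:R * moment p 0 - C * S]) w ->
    E * S <= `|score eps p n th w - \sum_(i < n) weighted_mean (tilt A r) y i|.
  move=> /negP; rewrite -leNgt => h; apply: le_trans (ler_norm _).
  have h1 : C1 * G <= C1 * (M * S) by rewrite ler_wpM2l.
  have h2 : r * (gauss_tail A * (n%:R - C2 * G)) >=
      s * gauss_tail A * S - s * gauss_tail A * C2 * M.
    have -> : r * (gauss_tail A * (n%:R - C2 * G)) =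
        s * gauss_tail A * S - s * gauss_tail A * C2 * (G / S).
      by rewrite -SS /r; field; rewrite gt_eqF.
    rewrite lerB// ler_wpM2l ?mulr_ge0// ?(ltW q0)//.
    by rewrite ler_pdivrMr.
  have h3 : (C1 * M + C + E + 1) * S <= s * gauss_tail A * S.
    by rewrite ler_wpM2r// ltW.
  move: h mean_le h1 h2 h3 YS; clear.
  move: (score _ _ _ _ _) (\sum_(i < n) weighted_mean _ _ _) (r * _) => a b c.
  move: (s * gauss_tail A * S) (s * gauss_tail A * C2 * M) (n%:R * moment p 0).
  move=> u v m; rewrite !mulrDl; lra.
have := weighted_chebyshev heps st l0 l1 sy y0 (fun i => `|th i| `^ p)
  Sbound (measurableC mlt) dev.
move=> /le_trans; apply.
apply: (@le_trans _ _ ((\sum_(i < n) 2 * (g_ p (th i) ^+ 2 + D)) / (E * S) ^+ 2)).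
  rewrite ler_wpM2r ?invr_ge0 ?sqr_ge0//; apply: ler_sum => i _.
  apply: (le_trans (Rintegral_tilt_spread A0 (th i) p0 r01)).
  by rewrite ler_wpM2l//; have := wle (th i); rewrite mul1r.
rewrite -mulr_sumr big_split/= sumr_const card_ord.
rewrite ler_pdivrMr ?exprn_gt0//.
have G0 : 0 <= G by exact: sumr_ge0.
have G2 : \sum_(i < n) g_ p (th i) ^+ 2 <= M ^+ 2 * n%:R.
  rewrite (le_trans (sumr_sqr_le_sqr_sumr n g0))// -SS -exprMn.
  by rewrite lerXn2r// nnegrE// mulr_ge0// ltW.
rewrite exprMn SS (_ : D *+ n = D * n%:R); last by rewrite mulr_natr.
have E4 : 4 * (M ^+ 2 + D) <= E ^+ 2.
  by rewrite /E; move: MD0; move: (M ^+ 2 + D) => z z0; rewrite expr2; nra.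
exact: arith G2 (ler_wpM2r (ltW nR) E4).
Qed.

End lower_deviation.

(** * Critical values and consistency *)

Section rejection.
Context {d : measure_display} {T : measurableType d} {R : realType}
  (P : probability T R).
Variable eps : nat -> {RV P >-> R}.
Hypothesis heps : iid_standard_normal eps.
Variables (p : R).
Hypothesis p0 : 0 < p.

Definition cutoff (k : R) : R := Num.max k 0 `^ p.

Lemma le_powR_cutoff (k S : R) : 0 <= S -> (k <= S `^ p^-1) = (cutoff k <= S).
Proof.
move=> S0; rewrite /cutoff; have pV : 0 < p^-1 by rewrite invr_gt0.
have [k0|k0] := leP k 0.
  by rewrite powR0 ?gt_eqF// S0 (le_trans k0)// powR_ge0.
apply/idP/idP => h.
  have -> : S = (S `^ p^-1) `^ p by rewrite -powRrM mulVf ?gt_eqF// powRr1.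
  by apply: ge0_ler_powR; rewrite ?nnegrE ?powR_ge0// ltW.
have -> : k = (k `^ p) `^ p^-1 by rewrite -powRrM mulfV ?gt_eqF// powRr1// ltW.
by apply: ge0_ler_powR; rewrite ?nnegrE ?powR_ge0// ltW.
Qed.

(** Extends a row by 0 to all natural indices, because [score] and the product formulas take
    sequences indexed by [nat]. *)
Definition entry (n : nat) (x : 'rV[R]_n) (k : nat) : R :=
  if insub k is Some i then x ord0 i else 0.

Lemma entryE n (x : 'rV[R]_n) (i : 'I_n) : entry x i = x ord0 i.
Proof. by rewrite /entry valK. Qed.

Lemma expectation_pnorm_test (kappa : nat -> R) n (x : 'rV[R]_n) :
  'E_P[fun w => pnorm_test p kappa (x + noise_vec eps n w)%R]%E =
  P [set w | cutoff (kappa n) <= score eps p n (entry x) w].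
Proof.
rewrite -(expectation_indic P (measurable_score_ge eps p0 n (entry x) _)).
congr ('E_P[_])%E; apply/funext => w.
rewrite /pnorm_test !indicE; congr ((_ : bool)%:R).
have E : score eps p n (entry x) w =
    \sum_(i < n) `|(x + noise_vec eps n w) ord0 i| `^ p.
  by apply: eq_bigr => i _; rewrite entryE !mxE.
have S0 : 0 <= score eps p n (entry x) w.
  by apply: sumr_ge0 => i _; exact: powR_ge0.
apply/idP/idP => /set_mem h; apply/mem_set; move: h => /=.
  by rewrite /pnorm -E le_powR_cutoff.
by rewrite /pnorm -E le_powR_cutoff.
Qed.

Lemma probability_score_lt n th (c : R) :
  fine (P [set w | score eps p n th w < c]) =
  1 - fine (P [set w | c <= score eps p n th w]).
Proof.
have m := measurable_score_ge eps p0 n th c.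
have -> : [set w | score eps p n th w < c] = ~` [set w | c <= score eps p n th w].
  by apply/seteqP; split=> w /=; rewrite ltNge => /negP.
rewrite probability_setC// -[in LHS](fineK (fin_num_measure P _ m)).
by rewrite -EFinB.
Qed.

Lemma cvg_probability_fine (A : nat -> set T) (a : R) :
  (forall n, measurable (A n)) ->
  (P (A n) @[n --> \oo] --> a%:E)%E <-> fine (P (A n)) @[n --> \oo] --> a.
Proof.
move=> mA; split => [/fine_cvg//|h].
by apply: cvg_EFin h; apply: nearW => n; rewrite fin_num_measure.
Qed.

Let mom0 := moment p 0.

Lemma null_chebyshev n (s : R) (A : set T) : 0 < s -> measurable A ->
  (forall w, A w -> s <= `|score eps p n (fun=> 0) w - n%:R * mom0|) ->
  fine (P A) <= n%:R * spread p 0 / s ^+ 2.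
Proof.
move=> s0 mA AS; have := score_chebyshev heps p0 (n := n) (th := fun=> 0) s0 mA.
by rewrite /= !sumr_const card_ord -[moment p 0 *+ n]mulr_natl -[spread p 0 *+ n]mulr_natl; apply.
Qed.

(** A cutoff too far above the null mean would make the rejection probability at most [b < alpha];
    one too far below would make the acceptance probability at most [b < 1 - alpha]. Either
    contradicts the limit [alpha] for large [n]. *)
Lemma cutoff_bounds (c : nat -> R) (alpha : R) : 0 < alpha < 1 ->
  fine (P [set w | c n <= score eps p n (fun=> 0) w]) @[n --> \oo] --> alpha ->
  exists2 C : R, 0 <= C & \forall n \near \oo,
    n%:R * mom0 - C * Num.sqrt n%:R <= c n <= n%:R * mom0 + C * Num.sqrt n%:R.
Proof.
move=> /andP[a0 a1] ca.
have w0 : 0 <= spread p 0.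
  by apply: gauss_Rintegral_ge0 => x; rewrite sqr_ge0.
pose b := Num.min alpha (1 - alpha) / 2.
have b0 : 0 < b by rewrite divr_gt0// lt_min a0 subr_gt0.
have b_a : b < alpha.
  by rewrite /b ltr_pdivrMr// (le_lt_trans (y := alpha))// ?ge_min ?lexx//; lra.
have b_1a : b < 1 - alpha.
  by rewrite /b ltr_pdivrMr// (le_lt_trans (y := 1 - alpha))// ?ge_min ?lexx ?orbT//; lra.
(* Chosen so that the Chebyshev bound [spread p 0 / C^2] is at most [b]: with [z = spread p 0 / b]
   this says [z <= (1 + z)^2]. *)
pose C : R := 1 + spread p 0 / b.
have wb0 : 0 <= spread p 0 / b by rewrite divr_ge0// ltW.
have C0 : 0 < C by rewrite /C; lra.
exists C; first exact: ltW.
have Cb : spread p 0 / C ^+ 2 <= b.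
  rewrite ler_pdivrMr ?exprn_gt0//.
  have h : spread p 0 = spread p 0 / b * b by rewrite divfK// gt_eqF.
  rewrite {1}h mulrC ler_wpM2l ?(ltW b0)// /C.
  by move: wb0; move: (spread p 0 / b) => z z0; rewrite expr2; nra.
have bound n (A : set T) : (0 < n)%N -> measurable A ->
    (forall w, A w -> C * Num.sqrt n%:R <= `|score eps p n (fun=> 0) w - n%:R * mom0|) ->
    fine (P A) <= b.
  move=> n0 mA AS; have nR : 0 < n%:R :> R by rewrite ltr0n.
  apply: le_trans (null_chebyshev _ mA AS) _.
    by rewrite mulr_gt0// sqrtr_gt0.
  apply: le_trans Cb; rewrite exprMn sqr_sqrtr ?(ltW nR)//.
  rewrite invfM mulrA [n%:R * _]mulrC -!mulrA mulrCA [n%:R * _]mulrC.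
  by rewrite -!mulrA mulVf ?mulr1 ?gt_eqF// mulrC.
have a1b : alpha < 1 - b by move: b_1a; lra.
near=> n.
have n0 : (0 < n)%N by near: n; exact: nbhs_infty_gt.
have hb : b < fine (P [set w | c n <= score eps p n (fun=> 0) w]).
  by near: n; exact: (cvgr_gt _ ca).
have h1b : fine (P [set w | c n <= score eps p n (fun=> 0) w]) < 1 - b.
  by near: n; exact: (cvgr_lt _ ca).
have mge := measurable_score_ge eps p0 n (fun=> 0) (c n).
have mlt := measurable_score_lt eps p0 n (fun=> 0) (c n).
apply/andP; split; rewrite leNgt; apply/negP => h.
  suff : fine (P [set w | score eps p n (fun=> 0) w < c n]) <= b.
    by rewrite probability_score_lt; move: h1b; lra.
  apply: (bound n) => // w /= hw; rewrite distrC (le_trans _ (ler_norm _))//.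
  by move: hw h; lra.
suff : fine (P [set w | c n <= score eps p n (fun=> 0) w]) <= b.
  by move: hb; lra.
apply: (bound n) => // w /= hw; rewrite (le_trans _ (ler_norm _))//.
by move: hw h; lra.
Unshelve. all: by end_near. Qed.

Lemma consistency_sufficient (th : nat -> nat -> R) (c : nat -> R) (C : R) :
  0 <= C ->
  (\forall n \near \oo, c n <= n%:R * mom0 + C * Num.sqrt n%:R) ->
  (\sum_(i < n) g_ p (th n i)) / Num.sqrt n%:R @[n --> \oo] --> +oo ->
  fine (P [set w | c n <= score eps p n (th n) w]) @[n --> \oo] --> (1 : R).
Proof.
move=> C0 cle Goo.
have [k k0 mge] := moment_ge p0.
apply/cvgrPdist_le => e e0.
(* Chebyshev at distance [k G / 2], with [G] the sum of the [g_p], gives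
   [4 del / k^2 + 4 D n / (k G)^2]; this [del] makes the first term [e / 2]. *)
pose del := e * k ^+ 2 / 8.
have k2 : 0 < k ^+ 2 by rewrite exprn_gt0.
have del0 : 0 < del by rewrite divr_gt0// mulr_gt0.
have [D D0 wle] := spread_le p0 del0.
(* From [G >= X sqrt n], the middle summand makes the second Chebyshev term at most [e / 2], the
   leading 1 giving [X^2 >= X]. The last summand gives [C sqrt n <= k G / 2], so half of the mean
   shift remains above the cutoff. *)
pose X : R := 1 + 8 * D / (k ^+ 2 * e) + 2 * C / k.
have X1 : 0 <= 8 * D / (k ^+ 2 * e).
  by rewrite divr_ge0 ?mulr_ge0//; exact: ltW.
have X2 : 0 <= 2 * C / k by rewrite divr_ge0 ?mulr_ge0 ?(ltW k0).
move/cvgryPge : Goo => /(_ X) GX.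
near=> n.
have n0 : (0 < n)%N by near: n; exact: nbhs_infty_gt.
have nR : 0 < n%:R :> R by rewrite ltr0n.
have S0 : 0 < Num.sqrt n%:R :> R by rewrite sqrtr_gt0.
have hG : X <= (\sum_(i < n) g_ p (th n i)) / Num.sqrt n%:R by near: n.
have hc : c n <= n%:R * mom0 + C * Num.sqrt n%:R by near: n.
have mlt := measurable_score_lt eps p0 n (th n) (c n).
rewrite -probability_score_lt ger0_norm; last by rewrite fine_ge0.
pose G := \sum_(i < n) g_ p (th n i).
pose S : R := Num.sqrt n%:R.
have SS : S ^+ 2 = n%:R by rewrite sqr_sqrtr// ltW.
have GX1 : X * S <= G by rewrite -ler_pdivlMr.
have XS : 0 < X * S by rewrite mulr_gt0// /X; move: X1 X2; lra.
have G0 : 0 < G by exact: lt_le_trans XS GX1.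
have GC : 2 * C * S <= k * G.
  have -> : 2 * C * S = k * (2 * C / k * S) by field; rewrite gt_eqF.
  by rewrite ler_pM2l// (le_trans _ GX1)// ler_wpM2r ?(ltW S0)// /X; move: X1; lra.
have s0 : 0 < k / 2 * G by rewrite mulr_gt0// divr_gt0.
have meanG : n%:R * mom0 + k * G <= \sum_(i < n) moment p (th n i).
  rewrite /G mulr_sumr mulr_natl -[in mom0 *+ n](card_ord n) -sumr_const.
  by rewrite -big_split/=; apply: ler_sum => i _; exact: mge.
apply: le_trans (score_chebyshev heps p0 (n := n) (th := th n) s0 mlt _) _.
  move=> w /= hw; rewrite distrC (le_trans _ (ler_norm _))//.
  move: hw hc GC meanG; rewrite -/S.
  move: (score _ _ _ _ _) (\sum_(i < n) moment _ _) (n%:R * mom0) => a b m.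
  lra.
have sumw : \sum_(i < n) spread p (th n i) <= del * G ^+ 2 + D * n%:R.
  apply: (@le_trans _ _ (\sum_(i < n) (del * g_ p (th n i) ^+ 2 + D))).
    by apply: ler_sum => i _; exact: wle.
  rewrite big_split/= sumr_const card_ord mulr_natr lerD2r -mulr_sumr.
  rewrite ler_wpM2l ?(ltW del0)//.
  by apply: (sumr_sqr_le_sqr_sumr n (F := fun i => g_ p (th n i))) => i; exact: g_ge0.
rewrite ler_pdivrMr ?exprn_gt0// (le_trans sumw)//.
have X8 : 8 * D <= X ^+ 2 * (k ^+ 2 * e).
  rewrite -ler_pdivrMr ?mulr_gt0//.
  move: X1 X2; rewrite /X; move: (8 * D / _) (2 * C / k) => u v u0 v0.
  by rewrite expr2; nra.
have G2 : X ^+ 2 * n%:R <= G ^+ 2.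
  by rewrite -SS -exprMn lerXn2r// ?nnegrE ltW.
have Dn : 8 * (D * n%:R) <= G ^+ 2 * (k ^+ 2 * e).
  rewrite mulrA (le_trans (ler_wpM2r (ltW nR) X8))// mulrAC ler_wpM2r//.
  by rewrite ltW// mulr_gt0.
rewrite /del exprMn expr_div_n.
move: Dn; move: (G ^+ 2) (k ^+ 2) (D * n%:R) => x y z.
move=> h; rewrite (_ : e * (y / 2 ^+ 2 * x) = e * y / 8 * x + x * (y * e) / 8).
  by rewrite lerD2l ler_pdivlMr// mulrC.
by field.
Unshelve. all: by end_near. Qed.

(** No subsequence is extracted: [eta] and [Y] depend on the bound [M] but not on [n] or the shifts,
    so at each large [n] a ratio below [M] would by itself keep the rejection probability at most
    [1 - eta]. *)
Lemma consistency_necessary (th : nat -> nat -> R) (c : nat -> R) (C : R) :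
  (\forall n \near \oo, n%:R * mom0 - C * Num.sqrt n%:R <= c n) ->
  fine (P [set w | c n <= score eps p n (th n) w]) @[n --> \oo] --> (1 : R) ->
  (\sum_(i < n) g_ p (th n i)) / Num.sqrt n%:R @[n --> \oo] --> +oo.
Proof.
move=> cge P1; apply/cvgryPge => M.
have [eta [Y [eta0 low]]] := score_lower_deviation heps C p0 (normr_ge0 M).
near=> n.
have n0 : (0 < n)%N by near: n; exact: nbhs_infty_gt.
have nR : 0 < n%:R :> R by rewrite ltr0n.
have S0 : 0 < Num.sqrt n%:R :> R by rewrite sqrtr_gt0.
have hP : 1 - eta < fine (P [set w | c n <= score eps p n (th n) w]).
  by near: n; apply: (cvgr_gt _ P1); rewrite gtrBl.
have hc : n%:R * mom0 - C * Num.sqrt n%:R <= c n by near: n.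
have hY : Y <= Num.sqrt n%:R.
  have : Y ^+ 2 <= n%:R by near: n; exact: nbhs_infty_ger.
  by rewrite -(@ler_sqrt _ _ n%:R) ?(ltW nR)// sqrtr_sqr; apply: le_trans; exact: ler_norm.
rewrite leNgt; apply/negP => hM.
have hG : \sum_(i < n) g_ p (th n i) <= `|M| * Num.sqrt n%:R.
  by rewrite -ler_pdivrMr// (le_trans (ltW hM))// ler_norm.
have lt_c : fine (P [set w | score eps p n (th n) w <
                             n%:R * mom0 - C * Num.sqrt n%:R])
   <= fine (P [set w | score eps p n (th n) w < c n]).
  apply: fine_le; rewrite ?fin_num_measure//; try exact: measurable_score_lt.
  apply: le_measure; rewrite ?inE; try exact: measurable_score_lt.
  by move=> w /= /lt_le_trans; apply.
have := le_trans (low n (th n) n0 hY hG) lt_c.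
by rewrite probability_score_lt; move: hP; lra.
Unshelve. all: by end_near. Qed.

End rejection.

Theorem theorem3p1 (R : realType) (d : measure_display) (T : measurableType d)
    (P : probability T R) (eps : nat -> {RV P >-> R})
    (heps : iid_standard_normal eps)
    (p alpha : R) (hp : 0 < p) (halpha : 0 < alpha < 1)
    (kappa : nat -> R)
    (hkappa : tests_of_asymptotic_size eps alpha (pnorm_test p kappa))
    (theta : triangular_array R) :
  consistency_set eps (pnorm_test p kappa) theta <->
  (\sum_(i < n) g_ p (theta n ord0 i)) / Num.sqrt n%:R @[n --> \oo] --> +oo.
Proof.
pose c n := cutoff p (kappa n).
have mge n th := measurable_score_ge eps hp n th (c n).
have [_ size] := hkappa.
have [C C0 bounds] : exists2 C : R, 0 <= C & \forall n \near \oo,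
    n%:R * moment p 0 - C * Num.sqrt n%:R <= c n <= n%:R * moment p 0 + C * Num.sqrt n%:R.
  apply: (cutoff_bounds heps hp halpha).
  apply/(@cvg_probability_fine _ _ _ P) => //.
  move: size; apply: cvg_trans; apply: near_eq_cvg; apply: nearW => n.
  (* The null hypothesis is treated as a shift by 0, so that one rejection formula covers both
     cases. *)
  rewrite -(_ : (fun w => pnorm_test p kappa (0 + noise_vec eps n w)%R) =
                fun w => pnorm_test p kappa (noise_vec eps n w)); last first.
    by apply/funext => w; rewrite add0r.
  rewrite expectation_pnorm_test//; congr (P _).
  apply/seteqP; split=> w /=; rewrite (_ : score _ _ _ _ _ = score eps p n (fun=> 0) w)//;
    by apply: eq_bigr => i _; rewrite entryE mxE.
have sumE : (fun n => (\sum_(i < n) g_ p (entry (theta n) i)) / Num.sqrt n%:R) =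
            (fun n => (\sum_(i < n) g_ p (theta n ord0 i)) / Num.sqrt n%:R).
  apply/funext => n; congr (_ / _); apply: eq_bigr => i _.
  by rewrite entryE.
rewrite -sumE /consistency_set/=.
have -> : (fun n => 'E_P[fun w => pnorm_test p kappa (theta n + noise_vec eps n w)%R]%E) =
   (fun n => P [set w | c n <= score eps p n (entry (theta n)) w]).
  by apply/funext => n; rewrite expectation_pnorm_test.
have cvgP := @cvg_probability_fine _ _ _ P _ 1 (fun n => mge n (entry (theta n))).
split=> [/cvgP|h].
  apply: (consistency_necessary heps hp (th := fun n => entry (theta n)) (c := c) (C := C)).
  by apply: filterS bounds => n /andP[].
apply/cvgP; apply: (consistency_sufficient heps hp (th := fun n => entry (theta n)) (c := c) C0) h.
by apply: filterS bounds => n /andP[].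
Qed.
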